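(* Let $N\ge 1$ and $n\ge 1$ be integers and let $X_1,\dots,X_n$ be independent random vectors, each uniformly distributed on the unit sphere $S^{N-1}\subset\mathbb{R}^N$. Then for all real numbers $a_1,\dots,a_n$, \[ \Big\|\sum_{j=1}^n a_jX_j\Big\|_{\psi_2}\le b(N)\Big(\sum_{j=1}^n a_j^2\Big)^{1/2},\qquad b(N):=\sqrt{\frac{2}{N}}\sqrt{\frac{1}{1-(1/2)^{2/N}}}. \] Moreover the constant $b(N)$ is optimal: for every $c<b(N)$ there exist $n\in\mathbb{N}$ and $a_1,\dots,a_n\in\mathbb{R}$ such that $\|\sum_{j=1}^n a_jX_j\|_{\psi_2}> c\,(\sum_{j=1}^n a_j^2)^{1/2}$ for i.i.d. $X_j$ uniformly distributed on $S^{N-1}$.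
   Context: For $q>0$ let $\psi_q(x)=\exp(x^q)-1$. For an $\mathbb{R}^N$-valued random vector $X$ on a probability space, its Orlicz $\psi_2$-norm is $\|X\|_{\psi_2}=\inf\{c>0:\ \mathbb{E}\,\psi_2(\|X\|/c)\le 1\}=\inf\{c>0:\ \mathbb{E}\exp(\|X\|^2/c^2)\le 2\}$, where $\|\cdot\|$ denotes the Euclidean norm on $\mathbb{R}^N$. *)

(* Defs.v *)
From HB Require Import structures.
From mathcomp Require Import all_boot all_order all_algebra.
From mathcomp Require Import all_classical all_reals all_analysis.
Set Implicit Arguments. Unset Strict Implicit. Unset Printing Implicit Defensive.
Import Order.TTheory GRing.Theory Num.Theory.
Import numFieldNormedType.Exports.
Local Open Scope classical_set_scope.
Local Open Scope ring_scope.

Section Defs.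
Variable R : realType.

(* Euclidean norm on R^N = 'rV[R]_N (the library norm on matrices is the sup norm) *)
Definition enorm (N : nat) (x : 'rV[R]_N) : R := Num.sqrt (\sum_(k < N) x 0 k ^+ 2).

(* Borel sigma-algebra on R^N: generated by the coordinate maps
   (= product of the Borel sigma-algebras of R) *)
Definition borelN (N : nat) : set (set 'rV[R]_N) :=
  <<s [set A | exists (k : 'I_N) (U : set R),
          measurable U /\ A = (fun x : 'rV[R]_N => x 0 k) @^-1` U] >>.

(* N-dimensional Lebesgue measure of a set, as the iterated Lebesgue integral
   of its indicator (Tonelli), one coordinate at a time *)
Definition upd (v : nat -> R) (i : nat) (x : R) : nat -> R :=
  fun k => if k == i then x else v k.

Fixpoint iint (N : nat) (f : (nat -> R) -> \bar R) (v : nat -> R) : \bar R :=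
  match N with
  | 0 => f v
  | N'.+1 => (\int[lebesgue_measure]_x iint N' f (upd v N' x))%E
  end.

Definition vol (N : nat) (A : set 'rV[R]_N) : \bar R :=
  iint N (fun v => (\1_A (\row_(k < N) v (nat_of_ord k)) : R)%:E) (fun _ => 0).

Definition unit_ball (N : nat) : set 'rV[R]_N := [set x | enorm x <= 1].

Definition cone (N : nat) (B : set 'rV[R]_N) : set 'rV[R]_N :=
  [set x | exists t y, [/\ 0 < t <= 1, B y, enorm y = 1 & x = t *: y]].

(* normalized surface (= cone) measure on S^{N-1} *)
Definition sphere_unif (N : nat) (B : set 'rV[R]_N) : \bar R :=
  (@vol N (cone B) * (@vol N (@unit_ball N))^-1)%E.

Context d (T : measurableType d) (P : probability T R).

Definition random_vector (N : nat) (X : T -> 'rV[R]_N) : Prop :=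
  forall k : 'I_N, measurable_fun [set: T] (fun w => X w 0 k).

Definition sigmaRV (N : nat) (X : T -> 'rV[R]_N) : set (set T) :=
  [set A | exists B, borelN B /\ A = X @^-1` B].

Definition mutually_independent (N n : nat) (X : 'I_n -> T -> 'rV[R]_N) : Prop :=
  forall A : 'I_n -> set T, (forall j, sigmaRV (X j) (A j)) ->
    P (\bigcap_(j in [set: 'I_n]) A j) = (\prod_(j < n) P (A j))%E.

Definition uniform_on_sphere (N : nat) (X : T -> 'rV[R]_N) : Prop :=
  random_vector X /\ forall B, borelN B -> P (X @^-1` B) = sphere_unif B.

(* Orlicz psi_2 norm: inf { c > 0 : E exp(|X|^2 / c^2) <= 2 } (inf of empty = +oo) *)
Definition psi2_norm (N : nat) (X : T -> 'rV[R]_N) : \bar R :=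
  ereal_inf [set c%:E | c in [set c : R | 0 < c /\
     (\int[P]_w (expR (enorm (X w) ^+ 2 / c ^+ 2))%:E <= 2%:E)%E]].

End Defs.

Definition bconst (R : realType) (N : nat) : R :=
  Num.sqrt (2 / N%:R) * Num.sqrt (1 / (1 - (2^-1) `^ (2 / N%:R))).

(* Main.v *)
(** For a standard Gaussian vector G in R^N, exp(s|x|^2) = E exp(sqrt(2s)<x, G>),
so by Tonelli and independence E exp(s|S|^2), S = sum_j a_j X_j, is the
expectation over G of prod_j M(sqrt(2s) a_j G), where M(y) = E exp<y, X_j>.
The vector G factors as |G| times an independent uniform direction, and
E|G|^2 = N; Jensen's inequality for u |-> u^k applied to |G|^2 then compares the
even moments of <y, X_j> with those of <y, G>/sqrt N and gives
1 + |y|^2/2N <= M(y) <= exp(|y|^2/2N).  The upper bound yields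
E exp(s|S|^2) <= (1 - 2s|a|^2/N)^(-N/2), which is 2 exactly when
1/s = b(N)^2 |a|^2.  For a_j = n^(-1/2) the lower bound and monotone convergence
show that (1 - 2s/N)^(-N/2) is approached as n grows, hence optimality. *)
Require Import Defs.
From HB Require Import structures.
From mathcomp Require Import all_boot all_order all_algebra.
From mathcomp Require Import finmap.
From mathcomp Require Import all_classical all_reals all_analysis.
From mathcomp Require Import measurable_realfun.
From mathcomp Require Import ring lra.
Import Order.TTheory GRing.Theory Num.Theory.
Import numFieldNormedType.Exports.
Set Implicit Arguments. Unset Strict Implicit. Unset Printing Implicit Defensive.
Local Open Scope classical_set_scope.
Local Open Scope ring_scope.

(** * Positive functionals and measures *)

Section positive_functional.
Local Open Scope ereal_scope.
Context (R : realType).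

(** The uniform law is prescribed only through volumes of cones, and volume only as an iterated
    integral of an indicator; neither comes with a theory of integration. Both are therefore treated
    as functionals on nonnegative functions that are additive, homogeneous and continuous along
    increasing sequences. On measurable functions such a functional is determined by its values on
    indicators and is the integral of a measure, so identities checked on sets pass to functions.
    The independence of radius and direction needs no surface measure and no explicit radial law: by
    scaling, the cone over B cut at radius t has volume t^N times that of the cone cut at radius 1,
    a product of a factor in t and a factor in B. That the unit ball has nonzero volume and the
    origin volume zero is deduced from the existence of a uniform vector. The law being symmetric,
    exp may be replaced by cosh, whose series has nonnegative terms and can be integrated term by
    term. Jensen's inequality serves the upper bound on M only; the lower bound keeps the quadratic
    term, which is exact because E|G|^2 = N. *)

Record posfun d (T : measurableType d) (Phi : (T -> \bar R) -> \bar R) : Prop :=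
  PosFun {
  posfun_ge0 : forall f, (forall x, 0 <= f x) -> 0 <= Phi f ;
  posfunD : forall f g : T -> \bar R, measurable_fun setT f -> (forall x, 0 <= f x) ->
    measurable_fun setT g -> (forall x, 0 <= g x) ->
    Phi (fun x => f x + g x) = Phi f + Phi g ;
  posfunZ : forall (k : R) (f : T -> \bar R), (0 <= k)%R ->
    measurable_fun setT f -> (forall x, 0 <= f x) ->
    Phi (fun x => k%:E * f x) = k%:E * Phi f ;
  posfun_cvg : forall g : nat -> T -> \bar R,
    (forall n, measurable_fun setT (g n)) -> (forall n x, 0 <= g n x) ->
    (forall x, nondecreasing_seq (g ^~ x)) ->
    Phi (g n) @[n --> \oo] --> Phi (fun x => limn (g ^~ x)) }.

Section theory.
Context d (T : measurableType d).
Implicit Types Phi Psi : (T -> \bar R) -> \bar R.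

Lemma posfun_integral (mu : {measure set T -> \bar R}) :
  posfun (fun f => \int[mu]_x f x).
Proof.
split => [f f0|f g mf f0 mg g0|k f k0 mf f0|g mg g0 ndg].
- by apply: integral_ge0.
- by apply: ge0_integralD.
- by apply: ge0_integralZl_EFin.
- by apply: cvg_monotone_convergence => // x _; exact: ndg.
Qed.

Lemma posfun0 Phi : posfun Phi -> Phi (fun=> 0) = 0.
Proof.
move=> pPhi; rewrite -[RHS](mul0e (Phi (fun=> 0))) -(posfunZ pPhi)//.
by congr (Phi _); apply/funext => x; rewrite mule0.
Qed.

Lemma posfun_sum Phi (I : Type) (s : seq I) (F : I -> T -> \bar R) :
  posfun Phi -> (forall i, measurable_fun setT (F i)) ->
  (forall i x, 0 <= F i x) ->
  Phi (fun x => \sum_(i <- s) F i x) = \sum_(i <- s) Phi (F i).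
Proof.
move=> pPhi mF F0; elim: s => [|i s ih].
  rewrite big_nil -[RHS](posfun0 pPhi); congr (Phi _).
  by apply/funext => x; rewrite big_nil.
rewrite big_cons -ih -(posfunD pPhi)//.
- by congr (Phi _); apply/funext => x; rewrite big_cons.
- exact: emeasurable_sum.
- by move=> x; exact: sume_ge0.
Qed.

Import HBNNSimple.

(** A nonnegative measurable function is the increasing limit of simple functions, that is of finite
    nonnegative combinations of indicators, so the three rules carry the equality from indicators to
    [f]. *)
Lemma eq_posfun Phi Psi : posfun Phi -> posfun Psi ->
  (forall A, measurable A -> Phi (EFin \o \1_A) = Psi (EFin \o \1_A)) ->
  forall f, measurable_fun setT f -> (forall x, 0 <= f x) -> Phi f = Psi f.
Proof.
move=> pPhi pPsi eqPP f mf f0.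
pose f_ := nnsfun_approx measurableT mf.
have fE : f = (fun x => limn (fun n => (f_ n x)%:E)).
  apply/funext => x; apply/esym/cvg_lim => //.
  exact: (cvg_nnsfun_approx measurableT mf (fun x _ => f0 x)).
have lim_ Xi : posfun Xi -> Xi f = limn (fun n => Xi (EFin \o f_ n)).
  move=> pXi; rewrite {1}fE; apply/esym/cvg_lim => //.
  apply: (posfun_cvg pXi (g := fun n => EFin \o f_ n)).
  - by move=> n; apply/measurable_EFinP.
  - by move=> n x; rewrite lee_fin.
  - by move=> x m n mn; rewrite lee_fin; exact/lefP/nd_nnsfun_approx.
rewrite !lim_//; congr (limn _); apply/funext => n.
have simple Xi : posfun Xi -> Xi (EFin \o f_ n) =
    \sum_(r <- fset_set (range (f_ n)))
      r%:E * Xi (EFin \o \1_(f_ n @^-1` [set r])).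
  move=> pXi.
  (* [posfun_sum] asks for nonnegative terms at every index [r], hence the truncation [Num.max r 0];
     it changes nothing on the range of a nonnegative simple function. *)
  transitivity (Xi (fun x => \sum_(r <- fset_set (range (f_ n)))
      (Num.max r 0)%:E * (EFin \o \1_(f_ n @^-1` [set r])) x)).
    congr (Xi _); apply/funext => x /=.
    rewrite fimfunE fsbig_finite//= -sumEFin.
    rewrite big_seq [RHS]big_seq; apply: eq_bigr => r.
    rewrite in_fset_set// inE => -[z _ <-].
    by rewrite max_l.
  rewrite posfun_sum//; last 2 first.
  - move=> r; apply: emeasurable_funM => //.
    by apply/measurable_EFinP; apply: measurable_indic.
  - by move=> r x; apply: mule_ge0; rewrite lee_fin// le_max lexx orbT.
  rewrite big_seq [RHS]big_seq; apply: eq_bigr => r.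
  rewrite in_fset_set// inE => -[z _ <-].
  rewrite (posfunZ pXi).
  - by rewrite max_l.
  - by rewrite le_max lexx orbT.
  - by apply/measurable_EFinP; apply: measurable_indic.
  - by move=> x; rewrite lee_fin.
by rewrite !simple//; apply: eq_bigr => r _; rewrite eqPP.
Qed.

(** The image under [Z] of the functional weighted by the density [Y]. Laws of radii, directions and
    random vectors, and the Gaussian measure itself, are all of this form. *)
Lemma posfun_comp d' (T' : measurableType d') Phi (Z : T -> T') (Y : T -> R) :
  posfun Phi -> measurable_fun setT Z -> measurable_fun setT Y ->
  (forall x, 0 <= Y x)%R ->
  posfun (fun h : T' -> \bar R => Phi (fun x => h (Z x) * (Y x)%:E)).
Proof.
move=> pPhi mZ mY Y0.
have mhZ h : measurable_fun setT h ->
    measurable_fun setT (fun x => h (Z x) * (Y x)%:E).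
  move=> mh; apply: emeasurable_funM; last exact/measurable_EFinP.
  exact: measurableT_comp.
have hZ0 h : (forall x, 0 <= h x) -> forall x, 0 <= h (Z x) * (Y x)%:E.
  by move=> h0 x; rewrite mule_ge0// lee_fin.
split.
- by move=> f f0; apply: (posfun_ge0 pPhi) => //; exact: hZ0.
- move=> f g mf f0 mg g0.
  rewrite -(posfunD pPhi); [|exact: mhZ|exact: hZ0|exact: mhZ|exact: hZ0].
  by congr (Phi _); apply/funext => x; rewrite ge0_muleDl.
- move=> k f k0 mf f0; rewrite -(posfunZ pPhi)//; [|exact: mhZ|exact: hZ0].
  by congr (Phi _); apply/funext => x; rewrite muleA.
- move=> g mg g0 ndg.
  have := posfun_cvg pPhi (g := fun n x => g n (Z x) * (Y x)%:E).
  have -> : (fun x => limn (fun n => g n (Z x) * (Y x)%:E)) =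
            (fun x => limn (g^~ (Z x)) * (Y x)%:E).
    apply/funext => x; rewrite limeMr//.
    exact/ereal_nondecreasing_is_cvgn/ndg.
  apply.
  + by move=> n; exact: mhZ.
  + by move=> n; exact: hZ0.
  + by move=> x m n mn; rewrite lee_wpmul2r ?lee_fin//; exact: ndg.
Qed.

Lemma posfun_scale Phi (c : R) : (0 <= c)%R -> posfun Phi ->
  posfun (fun h => c%:E * Phi h).
Proof.
move=> c0 pPhi; split.
- by move=> f f0; rewrite mule_ge0 ?lee_fin ?(posfun_ge0 pPhi).
- move=> f g mf f0 mg g0; rewrite (posfunD pPhi)// ge0_muleDr//.
  exact: (posfun_ge0 pPhi).
  exact: (posfun_ge0 pPhi).
- by move=> k f k0 mf f0; rewrite (posfunZ pPhi)// muleCA.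
- by move=> g mg g0 ndg; apply: cvgeZl => //; apply: (posfun_cvg pPhi).
Qed.

End theory.

Section measure_of_posfun.
Context d (T : measurableType d) (Phi : (T -> \bar R) -> \bar R).
Hypothesis pPhi : posfun Phi.

(** The proof of [posfun Phi] is kept as an argument so that the measure structure can be attached
    to the term. *)
Definition posfun_measure of posfun Phi := fun A : set T => Phi (EFin \o \1_A).

Local Notation m := (posfun_measure pPhi).

Let m0 : m set0 = 0.
Proof.
rewrite /m /posfun_measure -[RHS](posfun0 pPhi); congr (Phi _).
by apply/funext => x /=; rewrite indic0.
Qed.

Let m_ge0 A : 0 <= m A.
Proof. by apply: (posfun_ge0 pPhi) => x; rewrite lee_fin. Qed.

Let m_semi_sigma_additive : semi_sigma_additive m.
Proof.
move=> F mF tF mUF.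
pose g n x := \sum_(0 <= i < n) (\1_(F i) x)%:E : \bar R.
have -> : (fun n => \sum_(0 <= i < n) m (F i)) = (fun n => Phi (g n)).
  apply/funext => n; rewrite /g (posfun_sum _ pPhi)// => i.
  by apply/measurable_EFinP; apply: measurable_indic.
have -> : m (\bigcup_n F n) = Phi (fun x => limn (g ^~ x)).
  congr (Phi _); apply/funext => x /=.
  rewrite indicE -indicE /g.
  by rewrite indic_bigcup.
apply: (posfun_cvg pPhi).
- by move=> n; apply: emeasurable_sum => i; apply/measurable_EFinP;
    apply: measurable_indic.
- by move=> n x; apply: sume_ge0 => i _; rewrite lee_fin.
- by move=> x; apply: ereal_nondecreasing_series => i _ _; rewrite lee_fin.
Qed.

HB.instance Definition _ := isMeasure.Build _ _ _ (posfun_measure pPhi)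
  m0 m_ge0 m_semi_sigma_additive.

Lemma integral_posfun_measure f : measurable_fun setT f ->
  (forall x, 0 <= f x) -> \int[posfun_measure pPhi]_x f x = Phi f.
Proof.
apply: (eq_posfun (posfun_integral _) pPhi) => A mA.
by rewrite integral_indic// setIT.
Qed.

End measure_of_posfun.
End positive_functional.

(** * Iterated Lebesgue integrals *)

Section coordinate_spaces.
Context (R : realType).

Definition seq_cylinder : set (set (nat -> R)) :=
  [set A | exists (k : nat) (U : set R),
    measurable U /\ A = (fun v => v k) @^-1` U].

Definition row_cylinder (N : nat) : set (set 'rV[R]_N) :=
  [set A | exists (k : 'I_N) (U : set R),
    measurable U /\ A = (fun x : 'rV[R]_N => x 0 k) @^-1` U].

(** [iint] integrates functions of whole sequences, so sequences as well as rows receive the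
    sigma-algebra generated by their coordinates. For rows its measurable sets are those of
    [borelN]. *)
Definition Rseq := g_sigma_algebraType seq_cylinder.
Definition Rrow N := g_sigma_algebraType (@row_cylinder N).

HB.instance Definition _ := Measurable.on Rseq.
HB.instance Definition _ N := Measurable.on (Rrow N).

Lemma measurable_Rseq_coord k : measurable_fun setT (fun v : Rseq => v k).
Proof.
move=> _ U mU; rewrite setTI; apply: sub_sigma_algebra.
by exists k, U.
Qed.

Lemma measurable_Rrow_coord N (k : 'I_N) :
  measurable_fun setT (fun x : Rrow N => (x : 'rV[R]_N) 0 k).
Proof.
move=> _ U mU; rewrite setTI; apply: sub_sigma_algebra.
by exists k, U.
Qed.

Lemma measurable_fun_Rseq d (T : measurableType d) (f : T -> Rseq) :
  (forall k, measurable_fun setT (fun t => f t k)) -> measurable_fun setT f.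
Proof.
move=> mf; apply: (@measurability _ _ T Rseq setT f seq_cylinder) => //.
move=> _ [_ [k [U [mU ->]] <-]].
by rewrite setTI -[X in measurable X]setTI; exact: (mf k).
Qed.

Lemma measurable_fun_Rrow d (T : measurableType d) N (f : T -> Rrow N) :
  (forall k, measurable_fun setT (fun t => (f t : 'rV[R]_N) 0 k)) ->
  measurable_fun setT f.
Proof.
move=> mf; apply: (@measurability _ _ T (Rrow N) setT f (@row_cylinder N)) => //.
move=> _ [_ [k [U [mU ->]] <-]].
by rewrite setTI -[X in measurable X]setTI; exact: (mf k).
Qed.

Lemma measurable_upd k :
  measurable_fun setT (fun p : Rseq * measurableTypeR R => upd p.1 k p.2 : Rseq).
Proof.
apply: measurable_fun_Rseq => j; rewrite /upd; case: (j == k).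
  exact: measurable_snd.
exact: (measurableT_comp (measurable_Rseq_coord j)
  (@measurable_fst _ _ Rseq (measurableTypeR R))).
Qed.

Definition row_of N (v : Rseq) : Rrow N := \row_(k < N) v (nat_of_ord k).

Lemma measurable_row_of N : measurable_fun setT (@row_of N).
Proof.
apply: measurable_fun_Rrow => k.
rewrite [X in measurable_fun _ X](_ : _ = fun v : Rseq => v k).
  exact: measurable_Rseq_coord.
by apply/funext => v; rewrite mxE.
Qed.

End coordinate_spaces.

Section iterated_integral.
Context (R : realType).
Local Open Scope ereal_scope.
Notation mu := (@lebesgue_measure R).
Implicit Types f g : Rseq R -> \bar R.

Lemma iint_ge0 k f v : (forall v, 0 <= f v) -> 0 <= iint k f v.
Proof.
by move=> f0; elim: k v => [|k ih] v//=; apply: integral_ge0 => x _.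
Qed.

(** Tonelli's theorem, one coordinate at a time: [upd] is jointly measurable in the sequence and the
    new coordinate, so each partial integral is measurable in the sequence. *)
Lemma measurable_iint k f : measurable_fun setT f -> (forall v, 0 <= f v) ->
  measurable_fun setT (iint k f : Rseq R -> \bar R).
Proof.
move=> mf f0; elim: k => [|k ih]//=.
have h := @measurable_fun_fubini_tonelli_F _ _ (Rseq R) (measurableTypeR R) R mu
  (fun p => iint k f (upd p.1 k p.2)).
apply: h.
  exact: (measurableT_comp ih (@measurable_upd R k)).
by move=> p; exact: iint_ge0.
Qed.

Lemma measurable_iint_upd k f v j : measurable_fun setT f ->
  (forall v, 0 <= f v) ->
  measurable_fun setT (fun x : measurableTypeR R => iint k f (upd v j x)).
Proof.
move=> mf f0.
have mu_ : measurable_fun setT (fun x : measurableTypeR R => upd v j x : Rseq R).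
  apply: measurable_fun_Rseq => i; rewrite /upd; case: (i == j).
    exact: measurable_id.
  exact: measurable_cst.
exact: (measurableT_comp (measurable_iint k mf f0) mu_).
Qed.

Lemma le_iint k f g v : measurable_fun setT f -> (forall v, 0 <= f v) ->
  measurable_fun setT g -> (forall v, f v <= g v) ->
  iint k f v <= iint k g v.
Proof.
move=> mf f0 mg fg; have g0 w : 0 <= g w by rewrite (le_trans (f0 w)).
elim: k v => [|k ih] v //=; apply: ge0_le_integral => //.
- by move=> x _; exact: iint_ge0.
- exact: measurable_iint_upd.
- exact: measurable_iint_upd.
Qed.

(** Evaluation at [v] has the property, and each further integration preserves it. The base point
    stays general in the induction because the inner integral is taken at [upd v k x]. *)
Lemma posfun_iint k v : posfun (fun f : Rseq R -> \bar R => iint k f v).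
Proof.
elim: k v => [|k ih] v.
  split => //= g _ _ ndg; exact/ereal_nondecreasing_is_cvgn/ndg.
split => [f f0|f g mf f0 mg g0|c f c0 mf f0|g mg g0 ndg] /=.
- exact: (@iint_ge0 k.+1).
- under eq_integral do rewrite (posfunD (ih _))//.
  by rewrite ge0_integralD//; try (by move=> *; apply: iint_ge0);
    exact: measurable_iint_upd.
- under eq_integral do rewrite (posfunZ (ih _))//.
  rewrite ge0_integralZl_EFin//; first by move=> *; apply: iint_ge0.
  exact: measurable_iint_upd.
- under [X in _ --> X]eq_integral => x _.
    rewrite -(cvg_lim _ (posfun_cvg (ih (upd v k x)) mg g0 ndg))//.
    over.
  apply: (@cvg_monotone_convergence _ _ _ mu) => //.
  + by move=> n; exact: measurable_iint_upd.
  + by move=> n x _; exact: iint_ge0.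
  + move=> x _ m n mn; apply: le_iint => // w; exact: ndg.
Qed.

(* [upd] overwrites the coordinates one at a time, hence only the coordinates
   of [v] of index at least [k] matter *)
Lemma iint_prod (n : nat) (h : nat -> R -> R) (c : nat -> R) k v :
  (forall i, measurable_fun setT (h i)) -> (forall i x, (0 <= h i x)%R) ->
  (forall i, \int[mu]_x (h i x)%:E = (c i)%:E) -> (k <= n)%N ->
  iint k (fun w : Rseq R => (\prod_(0 <= i < n) h i (w i))%:E) v =
  ((\prod_(0 <= i < k) c i) * (\prod_(k <= i < n) h i (v i)))%:E.
Proof.
move=> mh h0 hc; elim: k v => [|k ih] v kn /=.
  by rewrite [X in (X * _)%R]big_geq// mul1r.
under eq_integral do rewrite ih 1?ltnW//.
have -> : (fun x => ((\prod_(0 <= i < k) c i) *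
    (\prod_(k <= i < n) h i (upd v k x i)))%:E) =
    (fun x => ((\prod_(0 <= i < k) c i) * \prod_(k.+1 <= i < n) h i (v i))%:E *
              (h k x)%:E).
  apply/funext => x; rewrite -EFinM; congr (_%:E).
  rewrite [X in (_ * X)%R = _]big_ltn// {1}/upd eqxx -mulrA [in RHS](mulrC _ (h k x)); congr (_ * (_ * _))%R.
  apply: eq_big_nat => i /andP[ki _].
  by rewrite /upd gtn_eqF.
have c0 i : (0 <= c i)%R.
  by rewrite -lee_fin -hc integral_ge0// => x _; rewrite lee_fin.
have C0 : (0 <= (\prod_(0 <= i < k) c i) * \prod_(k.+1 <= i < n) h i (v i))%R.
  by rewrite mulr_ge0// prodr_ge0.
have mhk : measurable_fun setT (fun x => (h k x)%:E) by exact/measurable_EFinP.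
rewrite ge0_integralZl_EFin//; last by move=> x _; rewrite lee_fin.
rewrite hc -EFinM; congr (_%:E).
by rewrite big_nat_recr//=; ring.
Qed.

Lemma ge0_integralN (f : R -> \bar R) : measurable_fun setT f ->
  (forall x, 0 <= f x) -> \int[mu]_x f (- x)%R = \int[mu]_x f x.
Proof.
move=> mf f0.
have := @ge0_integral_pushforward _ _ _ (measurableTypeR R) R
  (-%R : measurableTypeR R -> measurableTypeR R) (@oppr_measurable R setT) mu setT f
  measurableT mf (fun x _ => f0 x).
rewrite preimage_setT => <-.
by apply: eq_measure_integral => A mA _; exact: (lebesgue_measureN mA).
Qed.

(** By uniqueness of Lebesgue measure: [t] times its image under dilation by [t] gives every
    half-open interval its length. *)
Lemma ge0_integral_scale_gt0 (t : R) (f : R -> \bar R) : (0 < t)%R ->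
  measurable_fun setT f -> (forall x, 0 <= f x) ->
  \int[mu]_x f x = t%:E * \int[mu]_x f (t * x)%R.
Proof.
move=> t0 mf f0; have nt0 : (0 <= t)%R by exact: ltW.
pose s (x : measurableTypeR R) : measurableTypeR R := (t * x)%R.
have ms : measurable_fun setT s by exact: mulrl_measurable.
have mE A : measurable A -> mu A = mscale (NngNum nt0) (pushforward mu s) A.
  move=> mA; apply: lebesgue_measure_unique => // _ [[a b] _ <-].
  rewrite -[RHS]/(t%:E * mu (s @^-1` `]a, b])).
  have -> : s @^-1` `]a, b] = `](a / t)%R, (b / t)%R]%classic.
    apply/seteqP; split => x /=; rewrite !in_itv/= /s.
      by rewrite ltr_pdivrMr// ler_pdivlMr// mulrC.
    by rewrite ltr_pdivrMr// ler_pdivlMr// mulrC.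
  rewrite !lebesgue_measure_itv/= !lte_fin ltr_pM2r ?invr_gt0//.
  case: ifPn => _; last by rewrite mule0.
  by rewrite -!EFinB -EFinM -mulrBl mulrC divfK// gt_eqF.
rewrite (eq_measure_integral (mscale (NngNum nt0) (pushforward mu s))); last first.
  by move=> A mA _; exact: mE.
rewrite ge0_integral_mscale//; congr (_ * _).
by rewrite (ge0_integral_pushforward ms) ?preimage_setT.
Qed.

(** The base point is scaled together with the variables so that the induction commutes with [upd];
    at the base point 0, the one needed for volumes, this scaling disappears. *)
Lemma iint_scale (t : R) f k v : (0 < t)%R -> measurable_fun setT f ->
  (forall v, 0 <= f v) ->
  iint k f (fun i => t * v i)%R =
  (t ^+ k)%:E * iint k (fun w => f (fun i => t * w i)%R) v.
Proof.
move=> t0 mf f0; elim: k v => [|k ih] v /=; first by rewrite expr0 mul1e.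
have mt : measurable_fun setT (fun w : Rseq R => (fun i => t * w i)%R : Rseq R).
  apply: measurable_fun_Rseq => i; apply: measurable_funM => //.
  exact: measurable_Rseq_coord.
rewrite (ge0_integral_scale_gt0 t0); last 2 first.
- exact: measurable_iint_upd.
- by move=> x; exact: iint_ge0.
rewrite exprS EFinM -muleA; congr (_ * _).
rewrite -ge0_integralZl_EFin//; last 3 first.
- by move=> x _; apply: iint_ge0.
- apply: measurable_iint_upd => //; exact: (measurableT_comp mf mt).
- by rewrite exprn_ge0// ltW.
apply: eq_integral => x _; rewrite -ih; congr (iint k f _).
by apply/funext => i; rewrite /upd; case: (i == k).
Qed.

Lemma iint_opp f k v : measurable_fun setT f -> (forall v, 0 <= f v) ->
  iint k f (fun i => - v i)%R = iint k (fun w => f (fun i => - w i)%R) v.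
Proof.
move=> mf f0; elim: k v => [|k ih] v //=.
rewrite -ge0_integralN; last 2 first.
- exact: measurable_iint_upd.
- by move=> x; exact: iint_ge0.
apply: eq_integral => x _; rewrite -ih; congr (iint k f _).
by apply/funext => i; rewrite /upd; case: (i == k).
Qed.
End iterated_integral.

(** * Gaussian measure *)

Section euclidean.
Context (R : realType) (N : nat).
Implicit Types x y : 'rV[R]_N.

Definition dotp x y : R := \sum_(k < N) x 0 k * y 0 k.
Definition sqnorm x : R := \sum_(k < N) x 0 k ^+ 2.

Lemma sqnorm_ge0 x : 0 <= sqnorm x.
Proof. by apply: sumr_ge0 => k _; exact: sqr_ge0. Qed.

Lemma enorm_sqr x : enorm x ^+ 2 = sqnorm x.
Proof. by rewrite sqr_sqrtr// sqnorm_ge0. Qed.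

Lemma dotpZl t x y : dotp (t *: x) y = t * dotp x y.
Proof. by rewrite mulr_sumr; apply: eq_bigr => k _; rewrite mxE mulrA. Qed.

Lemma dotpC x y : dotp x y = dotp y x.
Proof. by apply: eq_bigr => k _; rewrite mulrC. Qed.

Lemma dotpZr t x y : dotp x (t *: y) = t * dotp x y.
Proof. by rewrite dotpC dotpZl dotpC. Qed.

Lemma sqnormZ t x : sqnorm (t *: x) = t ^+ 2 * sqnorm x.
Proof. by rewrite mulr_sumr; apply: eq_bigr => k _; rewrite mxE exprMn. Qed.

Lemma enorm_ge0 x : 0 <= enorm x.
Proof. exact: sqrtr_ge0. Qed.

Lemma enormZ t x : 0 <= t -> enorm (t *: x) = t * enorm x.
Proof.
by move=> t0; rewrite /enorm -/(sqnorm _) sqnormZ sqrtrM ?sqr_ge0// sqrtr_sqr ger0_norm.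
Qed.

Lemma dotp_suml n (X : 'I_n -> 'rV[R]_N) (a : 'I_n -> R) y :
  dotp (\sum_(j < n) a j *: X j) y = \sum_(j < n) a j * dotp (X j) y.
Proof.
rewrite /dotp; under eq_bigr do rewrite summxE mulr_suml.
rewrite exchange_big /=; apply: eq_bigr => j _; rewrite mulr_sumr.
by apply: eq_bigr => k _; rewrite mxE mulrA.
Qed.

Lemma measurable_dotp d (T : measurableType d) (f g : T -> Rrow R N) :
  measurable_fun setT f -> measurable_fun setT g ->
  measurable_fun setT (fun t => dotp (f t) (g t)).
Proof.
move=> mf mg; apply: measurable_sum => k; apply: measurable_funM.
  exact: (measurableT_comp (measurable_Rrow_coord k) mf).
exact: (measurableT_comp (measurable_Rrow_coord k) mg).
Qed.

Lemma measurable_sqnorm : measurable_fun setT (fun x : Rrow R N => sqnorm x).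
Proof.
apply: measurable_sum => k; apply: measurable_funX.
exact: measurable_Rrow_coord.
Qed.

Lemma measurable_sqrt : measurable_fun setT (@Num.sqrt R).
Proof. by apply: continuous_measurable_fun; exact: sqrt_continuous. Qed.

Lemma measurable_enorm : measurable_fun setT (fun x : Rrow R N => enorm x).
Proof. exact: (measurableT_comp measurable_sqrt measurable_sqnorm). Qed.

End euclidean.

(** * Lebesgue measure on the space of rows *)

Section lebesgueN.
Context (R : realType) (N : nat).
Local Open Scope ereal_scope.
Notation mu := (@lebesgue_measure R).
Notation V := (Rrow R N).

Lemma posfun_vol :
  posfun (fun f : V -> \bar R => iint N (fun v => f (row_of N v)) (fun=> 0%R)).
Proof.
have m1 : measurable_fun setT (fun _ : Rseq R => 1%R : R) by [].
have := posfun_comp (posfun_iint N (fun=> 0%R)) (@measurable_row_of R N)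
  m1 (fun=> ler01).
congr posfun; apply/funext => f; congr (iint _ _ _).
by apply/funext => v; rewrite mule1.
Qed.

(** Unfolds to [vol], so [sphere_unif] is a quotient of values of this measure. *)
Definition lebN : set V -> \bar R := posfun_measure posfun_vol.
HB.instance Definition _ := Measure.on lebN.

Lemma integral_lebN (f : V -> \bar R) : measurable_fun setT f ->
  (forall x, 0 <= f x) ->
  \int[lebN]_x f x = iint N (fun v => f (row_of N v)) (fun=> 0%R).
Proof. exact: integral_posfun_measure. Qed.

Lemma measurable_rowZ (t : R) : measurable_fun setT (fun x : V => (t *: (x : 'rV[R]_N)) : V).
Proof.
apply: measurable_fun_Rrow => k.
rewrite [X in measurable_fun _ X](_ : _ = fun x : V => (t * (x : 'rV[R]_N) 0 k)%R).
  by apply: measurable_funM => //; exact: measurable_Rrow_coord.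
by apply/funext => x; rewrite mxE.
Qed.

Lemma integral_lebN_scale (t : R) (f : V -> \bar R) : (0 < t)%R ->
  measurable_fun setT f -> (forall x, 0 <= f x) ->
  \int[lebN]_x f x = (t ^+ N)%:E * \int[lebN]_x f (t *: (x : 'rV[R]_N))%R.
Proof.
move=> t0 mf f0; rewrite !integral_lebN//; last first.
  exact: (measurableT_comp mf (measurable_rowZ t)).
rewrite (_ : (fun=> 0%R) = (fun i : nat => t * (fun=> 0) i)%R); last first.
  by apply/funext => i; rewrite mulr0.
rewrite iint_scale//; last exact: (measurableT_comp mf (@measurable_row_of R N)).
congr (_ * _).
rewrite (_ : (fun i : nat => t * (fun=> 0) i)%R = (fun=> 0%R)); last first.
  by apply/funext => i; rewrite mulr0.
congr (iint _ _ _); apply/funext => v; congr f.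
by apply/rowP => k; rewrite !mxE.
Qed.

Lemma integral_lebN_opp (f : V -> \bar R) : measurable_fun setT f ->
  (forall x, 0 <= f x) ->
  \int[lebN]_x f x = \int[lebN]_x f ((-1) *: (x : 'rV[R]_N))%R.
Proof.
move=> mf f0; rewrite !integral_lebN//; last first.
  exact: (measurableT_comp mf (measurable_rowZ _)).
rewrite (_ : (fun=> 0%R) = (fun i : nat => - (fun=> 0) i)%R); last first.
  by apply/funext => i; rewrite oppr0.
rewrite iint_opp//; last exact: (measurableT_comp mf (@measurable_row_of R N)).
rewrite (_ : (fun i : nat => - (fun=> 0) i)%R = (fun=> 0%R)); last first.
  by apply/funext => i; rewrite oppr0.
congr (iint _ _ _); apply/funext => v; congr f.
by apply/rowP => k; rewrite !mxE mulN1r.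
Qed.

End lebesgueN.

Section gaussian.
Context (R : realType) (N : nat).
Local Open Scope ereal_scope.
Notation mu := (@lebesgue_measure R).
Notation V := (Rrow R N).
Notation phi := (@normal_pdf R 0 1).

(** Completing the square turns the integrand into [expR (y ^+ 2 / 2)] times the normal density of
    mean [y]. *)
Lemma integral_expR_normal_pdf (y : R) :
  \int[mu]_x (expR (y * x) * phi x)%:E = (expR (y ^+ 2 / 2))%:E.
Proof.
transitivity (\int[mu]_x ((expR (y ^+ 2 / 2))%:E * (normal_pdf y 1 x)%:E)).
  apply: eq_integral => x _; rewrite -EFinM; congr (_%:E).
  rewrite !normal_pdfE ?oner_neq0//.
  rewrite mulrCA [RHS]mulrCA /normal_fun -!expRD; congr (_ * expR _)%R.
  by field.
rewrite ge0_integralZl_EFin ?expR_ge0 ?integral_normal_pdf ?mule1//.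
- by move=> x _; rewrite lee_fin normal_pdf_ge0.
- by apply/measurable_EFinP; exact: measurable_normal_pdf.
Qed.

(** The integrand is [s] times the centred normal density of variance [s ^+ 2 = (1 - b)^-1]. *)
Lemma integral_expR_sqr_normal_pdf (b : R) : (b < 1)%R ->
  \int[mu]_x (expR (b * x ^+ 2 / 2) * phi x)%:E = ((Num.sqrt (1 - b))^-1)%:E.
Proof.
move=> b1; have b0 : (0 < 1 - b)%R by rewrite subr_gt0.
pose s : R := ((Num.sqrt (1 - b))^-1)%R.
have s0 : (0 < s)%R by rewrite invr_gt0 sqrtr_gt0.
have sE : (s ^+ 2 = (1 - b)^-1)%R by rewrite exprVn sqr_sqrtr ?ltW.
transitivity (\int[mu]_x (s%:E * (normal_pdf 0 s x)%:E)).
  apply: eq_integral => x _; rewrite -EFinM; congr (_%:E).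
  rewrite !normal_pdfE ?oner_neq0 ?gt_eqF//.
  have -> : normal_peak 1 = (s * normal_peak s)%R.
    rewrite /normal_peak expr1n mul1r -mulrnAr sqrtrM ?sqr_ge0// sqrtr_sqr.
    by rewrite ger0_norm ?ltW// invfM mulrA divff ?mul1r// gt_eqF.
  rewrite mulrCA [RHS]mulrA /normal_fun -!expRD; congr (_ * expR _)%R.
  rewrite sE; field.
  by rewrite gt_eqF.
rewrite ge0_integralZl_EFin ?integral_normal_pdf ?mule1 ?ltW//.
- by move=> x _; rewrite lee_fin normal_pdf_ge0.
- by apply/measurable_EFinP; exact: measurable_normal_pdf.
Qed.

Definition gauss_density (x : V) : R := (\prod_(k < N) phi ((x : 'rV[R]_N) 0 k))%R.

Lemma gauss_density_ge0 x : (0 <= gauss_density x)%R.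
Proof. by apply: prodr_ge0 => k _; exact: normal_pdf_ge0. Qed.

Lemma gauss_densityE x :
  (gauss_density x = normal_peak 1 ^+ N * expR (- (enorm x ^+ 2 / 2)))%R.
Proof.
rewrite /gauss_density enorm_sqr.
under eq_bigr do rewrite normal_pdfE ?oner_neq0//.
rewrite big_split /= prodr_const card_ord -expR_sum; congr (_ * expR _)%R.
rewrite /sqnorm mulr_suml -sumrN; apply: eq_bigr => k _.
by rewrite subr0 expr1n mulNr.
Qed.

Lemma measurable_gauss_density : measurable_fun setT gauss_density.
Proof.
rewrite (_ : gauss_density = fun x => (normal_peak 1 ^+ N * expR (- (enorm x ^+ 2 / 2)))%R).
  apply: measurable_funM => //; apply: measurableT_comp => //.
  apply: measurable_funN; apply: measurable_funM => //.
  by apply: measurable_funX; exact: measurable_enorm.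
by apply/funext => x; rewrite gauss_densityE.
Qed.

Definition posfun_gauss := posfun_comp (posfun_integral (@lebN R N))
  (@measurable_id _ V setT) measurable_gauss_density gauss_density_ge0.

Definition gaussN : set V -> \bar R := posfun_measure posfun_gauss.
HB.instance Definition _ := Measure.on gaussN.

Lemma integral_gaussN (f : V -> \bar R) : measurable_fun setT f ->
  (forall x, 0 <= f x) ->
  \int[gaussN]_x f x = \int[@lebN R N]_x (f x * (gauss_density x)%:E).
Proof. exact: integral_posfun_measure. Qed.

Lemma integral_gaussN_prod (h : 'I_N -> R -> R) (c : 'I_N -> R) :
  (forall k, measurable_fun setT (h k)) -> (forall k x, (0 <= h k x)%R) ->
  (forall k, \int[mu]_x (h k x * phi x)%:E = (c k)%:E) ->
  \int[gaussN]_x (\prod_(k < N) h k ((x : 'rV[R]_N) 0 k))%:E = (\prod_(k < N) c k)%:E.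
Proof.
move=> mh h0 hc.
have mp : measurable_fun setT (fun x : V => (\prod_(k < N) h k ((x : 'rV[R]_N) 0 k))%R).
  apply: measurable_prod => k _.
  exact: (measurableT_comp (mh k) (measurable_Rrow_coord k)).
have p0 (x : V) : (0 <= \prod_(k < N) h k ((x : 'rV[R]_N) 0 k))%R by exact: prodr_ge0.
have mE : measurable_fun setT (fun x : V => (\prod_(k < N) h k ((x : 'rV[R]_N) 0 k))%:E).
  exact/measurable_EFinP.
rewrite integral_gaussN//.
rewrite integral_lebN//; last 2 first.
- apply: emeasurable_funM => //; apply/measurable_EFinP.
  exact: measurable_gauss_density.
- by move=> x; rewrite mule_ge0// lee_fin// gauss_density_ge0.
(* [iint_prod] expects factors indexed by all naturals. Outside ['I_N] the default factor is 1,
   whose integral against [phi] is 1. *)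
pose H (i : nat) (x : R) : R := (oapp (h^~ x) 1 (insub i) * phi x)%R.
pose C (i : nat) : R := oapp c 1%R (insub i).
have HE (v : Rseq R) : (\prod_(k < N) h k (row_of N v 0 k))%:E *
    (gauss_density (row_of N v))%:E = (\prod_(0 <= i < N) H i (v i))%:E.
  rewrite -EFinM; congr (_%:E); rewrite /gauss_density -big_split big_mkord /=.
  by apply: eq_bigr => k _; rewrite mxE /H valK.
under eq_fun do rewrite HE.
rewrite (iint_prod (c := C))//.
- rewrite big_mkord [X in (_ * X)%R]big_geq// mulr1.
  by congr (_%:E); apply: eq_bigr => k _; rewrite /C valK.
- move=> i; apply: measurable_funM; last exact: measurable_normal_pdf.
  by case: insub => [k|] //=.
- move=> i x; rewrite mulr_ge0 ?normal_pdf_ge0//.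
  by case: insub => [k|] /=.
- move=> i; rewrite /H /C; case: insub => [k|] //=.
  by under eq_integral do rewrite mul1r; rewrite integral_normal_pdf.
Qed.

Lemma gaussN_mgf (y : 'rV[R]_N) :
  \int[gaussN]_x (expR (dotp y x))%:E = (expR (sqnorm y / 2))%:E.
Proof.
under eq_integral do rewrite /dotp expR_sum.
rewrite (integral_gaussN_prod (h := fun k x => expR (y 0%R k * x))
  (c := fun k => expR (y 0%R k ^+ 2 / 2))).
- by rewrite -expR_sum /sqnorm mulr_suml.
- move=> k; apply: measurableT_comp => //; exact: mulrl_measurable.
- by move=> k x; exact: expR_ge0.
- by move=> k; exact: integral_expR_normal_pdf.
Qed.

Lemma gaussN_mgf_sqr (b : R) : (b < 1)%R ->
  \int[gaussN]_x (expR (b * sqnorm x / 2))%:E = ((Num.sqrt (1 - b))^-1 ^+ N)%:E.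
Proof.
move=> b1.
under eq_integral do rewrite /sqnorm mulr_sumr mulr_suml expR_sum.
rewrite (integral_gaussN_prod (h := fun k x => expR (b * x ^+ 2 / 2))
  (c := fun=> (Num.sqrt (1 - b))^-1)%R).
- by rewrite prodr_const card_ord.
- move=> k; apply: measurableT_comp => //; apply: measurable_funM => //.
  by apply: measurable_funM => //; exact: exprn_measurable.
- by move=> k x; exact: expR_ge0.
- by move=> k; exact: integral_expR_sqr_normal_pdf.
Qed.

(** The total mass is the quadratic exponential moment at [b = 0]. *)
Lemma gaussN_setT : gaussN setT = 1.
Proof.
have := gaussN_mgf_sqr ltr01.
rewrite subr0 sqrtr1 invr1 expr1n.
under eq_integral do rewrite !mul0r expR0.
by rewrite integral_cst// mul1e.
Qed.

HB.instance Definition _ := Measure_isProbability.Build _ _ _ gaussN gaussN_setT.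

End gaussian.

(** * Polar decomposition *)

Section rays.
Context (R : realType).
Local Open Scope ereal_scope.

(** Distribution functions determine measures. The common values on rays are finite, so they can be
    subtracted to give the values on half-open intervals, an intersection-stable family that
    generates the Borel sets. *)
Lemma eq_posfun_ray (Phi Psi : (R -> \bar R) -> \bar R) (c : R -> R) :
  posfun Phi -> posfun Psi ->
  (forall t, Phi (EFin \o \1_(`]-oo, t]%classic)) = (c t)%:E) ->
  (forall t, Psi (EFin \o \1_(`]-oo, t]%classic)) = (c t)%:E) ->
  forall g, measurable_fun setT g -> (forall x, 0 <= g x) -> Phi g = Psi g.
Proof.
move=> pPhi pPsi PhiE PsiE.
have itvE (Xi : (R -> \bar R) -> \bar R) : posfun Xi ->
    (forall t, Xi (EFin \o \1_(`]-oo, t]%classic)) = (c t)%:E) ->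
    forall a b, (a < b)%R -> Xi (EFin \o \1_(`]a, b]%classic)) = (c b - c a)%:E.
  move=> pXi XiE a b ab.
  have : Xi (EFin \o \1_(`]-oo, b]%classic)) =
      Xi (EFin \o \1_(`]-oo, a]%classic)) + Xi (EFin \o \1_(`]a, b]%classic)).
    rewrite -(posfunD pXi).
    - congr (Xi _); apply/funext => x /=; rewrite -EFinD; congr (_%:E).
      rewrite !indicE !mem_setE !in_itv/=.
      have [xa|ax] := leP x a; last by rewrite add0r.
      by rewrite (le_trans xa (ltW ab)) addr0.
    - by apply/measurable_EFinP; apply: measurable_indic; exact: measurable_itv.
    - by move=> x; rewrite lee_fin.
    - by apply/measurable_EFinP; apply: measurable_indic; exact: measurable_itv.
    - by move=> x; rewrite lee_fin.
  rewrite !XiE.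
  case: (Xi (EFin \o \1_(`]a, b]%classic))) => [r| |] //= [->].
  by congr (_%:E); lra.
apply: (eq_posfun pPhi pPsi).
have oE A : ocitv A -> posfun_measure pPhi A = posfun_measure pPsi A.
  move=> /ocitvP[->|[[a b] /= ab ->]]; first by rewrite !measure0.
  by rewrite /posfun_measure (itvE _ pPhi)// (itvE _ pPsi).
have finE (k : nat) : posfun_measure pPhi `](- k%:R)%R, k%:R]%classic < +oo.
  rewrite /posfun_measure; have [k0|k0] := ltnP 0%N k.
    by rewrite (itvE _ pPhi PhiE) ?ltry// gtrN// ltr0n.
  move: k0; rewrite leqn0 => /eqP ->; rewrite oppr0 set_itvoc0.
  rewrite (_ : EFin \o _ = fun=> 0); last first.
    by apply/funext => x /=; rewrite indic0.
  by rewrite (posfun0 pPhi).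
have ocitvK (k : nat) : ocitv `](- k%:R)%R, k%:R : R]%classic.
  by exists ((- k%:R)%R, k%:R).
have mE : @measurable _ (measurableTypeR R) = <<s @ocitv R >> by [].
have mu_eq := (measure_unique (@ocitv R) (fun k : nat => `](- k%:R)%R, k%:R]%classic) mE
  (@ocitvI R) ocitvK (bigcup_itvT false false)
  (posfun_measure pPhi) (posfun_measure pPsi) oE finE).
by move=> A /mu_eq.
Qed.

End rays.

Section direction.
Context (R : realType) (N : nat).
Notation V := (Rrow R N).
Implicit Types x : 'rV[R]_N.

(** At the origin this is the zero vector, so [enormZdir] holds without exception. *)
Definition dir x : 'rV[R]_N := (enorm x)^-1 *: x.

Lemma enorm_eq0 x : (enorm x == 0) = (x == 0).
Proof.
apply/eqP/eqP => [x0|->]; last first.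
  rewrite /enorm big1 ?sqrtr0// => k _; by rewrite mxE expr0n.
apply/rowP => k; rewrite mxE; apply/eqP.
have : sqnorm x == 0 by rewrite -enorm_sqr x0 expr0n.
rewrite psumr_eq0; last by move=> i _; exact: sqr_ge0.
by move=> /allP/(_ k); rewrite mem_index_enum sqrf_eq0; exact.
Qed.

Lemma enormZdir x : enorm x *: dir x = x.
Proof.
rewrite /dir scalerA; have [/eqP|x0] := eqVneq (enorm x) 0.
  by rewrite enorm_eq0 => /eqP ->; rewrite scaler0.
by rewrite divff// scale1r.
Qed.

Lemma dirZ t x : 0 < t -> dir (t *: x) = dir x.
Proof.
move=> t0; rewrite /dir enormZ ?ltW// scalerA invfM -mulrA [_^-1 * t]mulrC mulrA.
by rewrite mulVf ?gt_eqF// mul1r.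
Qed.

Lemma enormN x : enorm ((-1) *: x) = enorm x.
Proof. by rewrite /enorm -/(sqnorm _) sqnormZ sqrrN expr1n mul1r. Qed.

Lemma dirN x : dir ((-1) *: x) = (-1) *: dir x.
Proof. by rewrite /dir enormN !scalerA mulrC. Qed.

Lemma measurable_dir : measurable_fun setT (dir : V -> V).
Proof.
apply: measurable_fun_Rrow => k.
rewrite [X in measurable_fun _ X](_ : _ =
    fun x : V => ((enorm x) `^ (-1) * (x : 'rV[R]_N) 0 k)%R).
  apply: measurable_funM; last exact: measurable_Rrow_coord.
  exact: (measurableT_comp (measurable_powR (-1)) (@measurable_enorm R N)).
by apply/funext => x; rewrite /dir mxE powR_inv1// enorm_ge0.
Qed.

(** The untruncated cone over [B] without its vertex; unlike [cone B], it is invariant under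
    positive dilations. *)
Definition dirset (B : set V) : set V := [set x | enorm x != 0 /\ B (dir x)].

Lemma measurable_dirset B : measurable B -> measurable (dirset B).
Proof.
move=> mB; rewrite (_ : dirset B =
    (setT `&` ((fun x : V => enorm x) @^-1` [set~ 0])) `&` (setT `&` (dir : V -> V) @^-1` B)).
  apply: measurableI.
    by apply: measurable_enorm => //; exact: measurableC.
  by apply: measurable_dir.
apply/seteqP; split => x /=.
  by move=> [/eqP x0 Bx]; split; split.
by move=> [[_ /eqP x0] [_ Bx]]; split.
Qed.

Lemma coneE B : cone B = dirset B `&` [set x | enorm x <= 1].
Proof.
apply/seteqP; split => x /=.
  move=> [t [y [/andP[t0 t1] By y1 ->]]].
  have e : enorm (t *: y) = t by rewrite enormZ ?ltW// y1 mulr1.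
  rewrite /dirset/= e dirZ// /dir y1 invr1 scale1r; split => //; split => //.
  by rewrite gt_eqF.
move=> [[x0 Bx] x1]; exists (enorm x), (dir x); split => //.
- by rewrite x1 lt_neqAle eq_sym x0 enorm_ge0.
- by rewrite /dir enormZ ?invr_ge0 ?enorm_ge0// mulVf.
- by rewrite enormZdir.
Qed.

Lemma measurable_unit_ball : measurable (@unit_ball R N : set V).
Proof.
rewrite (_ : @unit_ball R N = setT `&` ((fun x : V => enorm x) @^-1` `]-oo, 1])).
  by apply: measurable_enorm => //; exact: measurable_itv.
by apply/seteqP; split => x /=; rewrite in_itv/=; [split|case].
Qed.

Lemma measurable_cone (B : set V) : measurable B -> measurable (cone B : set V).
Proof.
move=> mB; rewrite coneE; apply: measurableI; first exact: measurable_dirset.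
exact: measurable_unit_ball.
Qed.

End direction.

Section polar.
Context (R : realType) (N : nat) d (T : measurableType d).
Hypothesis N0 : (0 < N)%N.
Variables (P : probability T R) (X : T -> 'rV[R]_N).
Hypothesis uX : uniform_on_sphere P X.
Local Open Scope ereal_scope.
Notation V := (Rrow R N).
Notation lam := (@lebN R N).
Notation gam := (@gaussN R N).

Lemma measurable_uniform : measurable_fun setT (X : T -> V).
Proof. by apply: measurable_fun_Rrow => k; exact: uX.1. Qed.

(** On the unit ball the Gaussian density is at least [1 / C], and its integral over the whole space
    is 1, so the volume is at most [C]. *)
Lemma lebN_ball_lty : lam (@unit_ball R N) < +oo.
Proof.
have pk : (0 < @normal_peak R 1 ^+ N)%R by rewrite exprn_gt0// normal_peak_gt0// oner_neq0.
pose C : R := (expR (1 / 2) / normal_peak 1 ^+ N)%R.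
have C0 : (0 <= C)%R by rewrite mulr_ge0 ?expR_ge0 ?invr_ge0 ?(ltW pk).
have mb := @measurable_unit_ball R N.
have gE : \int[lam]_x (gauss_density x)%:E = 1.
  have := @integral_gaussN R N (fun=> 1) (measurable_cst _) (fun=> lee01).
  rewrite integral_cst//= mul1e gaussN_setT => ->.
  by apply: eq_integral => x _; rewrite mul1e.
apply: (@le_lt_trans _ _ (\int[lam]_x (C%:E * (gauss_density x)%:E))).
  rewrite -[X in lam X]setIT -integral_indic//.
  apply: ge0_le_integral => //.
  - by apply/measurable_EFinP; exact: measurable_indic.
  - apply: emeasurable_funM => //; apply/measurable_EFinP.
    exact: measurable_gauss_density.
  - move=> x _; rewrite -EFinM lee_fin.
    rewrite indicE; case: (boolP (x \in @unit_ball R N)) => [|_]; last first.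
      by rewrite mulr_ge0 ?gauss_density_ge0.
    rewrite inE /unit_ball/= => x1; rewrite gauss_densityE /C mulrA divfK ?gt_eqF//.
    rewrite -expRD -[leLHS]expR0 ler_expR.
    have : (enorm x ^+ 2 <= 1)%R by rewrite expr_le1// enorm_ge0.
    by move: (enorm x ^+ 2)%R => u; lra.
rewrite ge0_integralZl_EFin// ?gE ?mule1 ?ltry//.
- by move=> x _; rewrite lee_fin gauss_density_ge0.
- by apply/measurable_EFinP; exact: measurable_gauss_density.
Qed.

Let r := fine (lam (@unit_ball R N)).

Lemma ball_fine : lam (@unit_ball R N) = r%:E.
Proof. by rewrite fineK// ge0_fin_numE// lebN_ball_lty. Qed.

Let pX (B : set V) : R := fine (P (X @^-1` B)).

Lemma pXE (B : set V) : measurable B -> P (X @^-1` B) = (pX B)%:E.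
Proof.
move=> mB; rewrite fineK// fin_num_measure//.
by rewrite -[X in measurable X]setTI; exact: measurable_uniform.
Qed.

Lemma cone_vol (B : set V) : measurable B -> lam (cone B) = (pX B * r)%:E.
Proof.
move=> mB.
have key (A : set V) : measurable A -> (pX A)%:E = lam (cone A) * (r%:E)^-1.
  by move=> mA; rewrite -pXE// uX.2// -ball_fine.
(* If the ball were null, the cone over the whole space would be null as well, and [X] would fall in
   the whole space with probability 0. *)
have r0 : r != 0%R.
  apply/eqP => r0; have := key setT measurableT.
  have -> : lam (cone setT) = 0.
    apply/eqP; rewrite -measure_le0 -[leRHS]/(0%:E) -r0 -ball_fine le_measure// ?inE.
    - exact: measurable_cone.
    - exact: measurable_unit_ball.
    - by rewrite coneE => x [].
  rewrite mul0e /pX preimage_setT probability_setT => -[].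
  by move/eqP; rewrite oner_eq0.
have := key B mB; rewrite inver (negbTE r0) => h.
rewrite EFinM h -muleA -EFinM mulVf// mule1//.
Qed.

(** The ball is the disjoint union of the origin and the cone over the whole space. Since the latter
    already has the volume [r] of the ball, by [cone_vol], nothing is left for the origin. *)
Lemma lebN_null : lam [set x : V | enorm x = 0%R] = 0.
Proof.
have bE : @unit_ball R N = cone (setT : set V) `|` [set x : V | enorm x = 0%R].
  rewrite coneE; apply/seteqP; split => x /=.
    by have [x0|x0] := eqVneq (enorm x) 0%R; [right|left].
  by move=> [[]//|]; rewrite /unit_ball/= => ->.
have mz : measurable [set x : V | enorm x = 0%R].
  rewrite (_ : [set x | _] = setT `&` ((fun x : V => enorm x) @^-1` [set 0%R])).
    by apply: measurable_enorm.
  by apply/seteqP; split => x //= [].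
have : lam (@unit_ball R N) = lam (cone (setT : set V)) + lam [set x : V | enorm x = 0%R].
  rewrite {1}bE measureU//; first exact: measurable_cone.
  by rewrite coneE; apply/seteqP; split => x //= -[[[/eqP]]].
rewrite ball_fine cone_vol// /pX preimage_setT probability_setT mul1r.
move/esym; case: (lam _) => [s| |]//= [].
by move=> h; congr (_%:E); lra.
Qed.

(** Dilation by [t] carries [cone B] onto the part of [dirset B] in the ball of radius [t], whence
    the factor [t ^+ N]. For [t <= 0] both sides vanish, as the vertex is excluded and [0 ^+ N = 0]
    for positive [N]. *)
Lemma lebN_radial (B : set V) t : measurable B ->
  \int[lam]_x ((\1_(`]-oo, t]%classic) (enorm x))%:E * (\1_(dirset B) x)%:E) =
  (pX B * r * Num.max t 0 ^+ N)%:E.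
Proof.
move=> mB.
have mD := measurable_dirset mB.
have [t0|t0] := ltP 0%R t; last first.
  rewrite expr0n gtn_eqF// mulr0 -[RHS](integral0 lam setT).
  apply: eq_integral => x _; rewrite !indicE.
  have [|_] := boolP (x \in dirset B); last by rewrite mule0.
  rewrite inE => -[x0 _]; have [|_] := boolP (enorm x \in _); last by rewrite mul0e.
  rewrite inE/= in_itv/= => xt; exfalso; move/negP: x0; apply.
  by rewrite eq_le enorm_ge0 (le_trans xt).
rewrite (integral_lebN_scale t0); last 2 first.
- apply: emeasurable_funM; apply/measurable_EFinP; last exact: measurable_indic.
  apply: (measurableT_comp _ (@measurable_enorm R N)).
  by apply: measurable_indic; exact: measurable_itv.
- by move=> x; rewrite mule_ge0// lee_fin.
rewrite mulrC EFinM -cone_vol//; congr (_ * _).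
rewrite -[X in lam X]setIT -integral_indic//; last exact: measurable_cone.
apply: eq_integral => x _; rewrite -EFinM; congr (_%:E).
rewrite coneE !indicE -natrM mulnb; congr (nat_of_bool _)%:R.
have e : enorm (t *: (x : 'rV[R]_N)) = (t * enorm x)%R by rewrite enormZ// ltW.
apply/andP/idP; rewrite !inE /dirset/= in_itv/= dirZ// e ger_pMr// mulf_eq0 (gt_eqF t0)/=.
  by move=> [? []].
by move=> [[? ?] ?].
Qed.

(* the radius and the direction of a Lebesgue-distributed vector are independent *)
Lemma lebN_radial_integral (B : set V) (g : R -> \bar R) : measurable B ->
  measurable_fun setT g -> (forall x, 0 <= g x) ->
  \int[lam]_x (g (enorm x) * (\1_(dirset B) x)%:E) =
  (pX B)%:E * \int[lam]_x (g (enorm x) * (\1_(dirset (setT : set V)) x)%:E).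
Proof.
move=> mB mg g0.
have m1 (A : set V) : measurable A -> measurable_fun setT (\1_(dirset A) : V -> R).
  by move=> mA; apply: measurable_indic; exact: measurable_dirset.
have i0 (A : set V) x : (0 <= (\1_(dirset A) : V -> R) x)%R by [].
have pf (A : set V) (mA : measurable A) := posfun_comp (posfun_integral lam)
  (@measurable_enorm R N) (m1 A mA) (i0 A).
have p0 : (0 <= pX B)%R by exact: fine_ge0.
have := eq_posfun_ray (c := fun t => pX B * r * Num.max t 0 ^+ N)%R
  (pf B mB) (posfun_scale p0 (pf setT measurableT)).
apply=> // t.
  exact: lebN_radial.
have := @lebN_radial setT t measurableT; rewrite /= => ->.
rewrite /pX preimage_setT probability_setT mul1r -EFinM; congr (_%:E).
by rewrite mulrA.
Qed.

(** The Gaussian density depends on the radius alone and merges with [g] into a radial weight [G].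
    For an indicator [h] the identity is then [lebN_radial_integral], and [eq_posfun] extends it to
    all [h]. *)
Lemma gaussN_polar (h : V -> \bar R) (g : R -> R) (c : R) :
  measurable_fun setT h -> (forall x, 0 <= h x) ->
  measurable_fun setT g -> (forall x, 0 <= g x)%R ->
  \int[gam]_x (g (enorm x))%:E = c%:E ->
  \int[gam]_x (h (dir x) * (g (enorm x))%:E) = c%:E * \int[P]_w h (X w).
Proof.
move=> mh h0 mg g0 gc.
pose G (s : R) : R := (g s * (normal_peak 1 ^+ N * expR (- (s ^+ 2 / 2))))%R.
have G0 s : (0 <= G s)%R.
  by rewrite mulr_ge0// mulr_ge0 ?expR_ge0// exprn_ge0// normal_peak_ge0.
have mG : measurable_fun setT G.
  apply: measurable_funM => //; apply: measurable_funM => //.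
  apply: measurableT_comp => //; apply: measurable_funN.
  by apply: measurable_funM => //; exact: exprn_measurable.
have mGe : measurable_fun setT (fun x : V => G (enorm x)).
  exact: (measurableT_comp mG (@measurable_enorm R N)).
have mge : measurable_fun setT (fun x : V => (g (enorm x))%:E).
  apply/measurable_EFinP; exact: (measurableT_comp mg (@measurable_enorm R N)).
have mD := measurable_dirset (@measurableT _ V).
have mhd : measurable_fun setT (fun x : V => h (dir x)).
  exact: (measurableT_comp mh (@measurable_dir R N)).
(* The indicator removes the origin, which is a null set and has no direction on the sphere. *)
pose Y (x : V) : R := (G (enorm x) * \1_(dirset (setT : set V)) x)%R.
have mY : measurable_fun setT Y.
  by apply: measurable_funM => //; exact: measurable_indic.
have Y0 x : (0 <= Y x)%R by rewrite mulr_ge0.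
have toY (k : V -> \bar R) : measurable_fun setT k -> (forall x, 0 <= k x) ->
    \int[gam]_x (k x * (g (enorm x))%:E) = \int[lam]_x (k x * (Y x)%:E).
  move=> mk k0; rewrite integral_gaussN; last 2 first.
  - exact: emeasurable_funM.
  - by move=> x; rewrite mule_ge0// lee_fin.
  apply: ge0_ae_eq_integral => //.
  - apply: emeasurable_funM; first exact: emeasurable_funM.
    by apply/measurable_EFinP; exact: measurable_gauss_density.
  - by apply: emeasurable_funM => //; exact/measurable_EFinP.
  - move=> x _; rewrite mule_ge0// ?mule_ge0// lee_fin//.
    exact: gauss_density_ge0.
  - by move=> x _; rewrite mule_ge0// lee_fin.
  exists [set x : V | enorm x = 0%R]; split.
  - rewrite (_ : [set x | _] = setT `&` ((fun x : V => enorm x) @^-1` [set 0%R])).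
      by apply: measurable_enorm.
    by apply/seteqP; split => x //= [].
  - exact: lebN_null.
  - move=> x /= hx; apply: contrapT => x0; apply: hx => _.
    rewrite -muleA -EFinM /Y /G gauss_densityE indicE mem_set ?mulr1//.
    by split => //; apply/eqP.
rewrite toY//.
have cE : c%:E = \int[lam]_x (Y x)%:E.
  rewrite -gc; have := toY (fun=> 1) (measurable_cst _) (fun=> lee01).
  by under eq_integral do rewrite mul1e; under [in RHS]eq_integral do rewrite mul1e.
have c0 : (0 <= c)%R.
  by rewrite -lee_fin cE; apply: integral_ge0 => x _; rewrite lee_fin.
have mX1 : measurable_fun setT (fun _ : T => 1%R : R) by [].
have := eq_posfun (posfun_comp (posfun_integral lam) (@measurable_dir R N) mY Y0)
  (posfun_scale c0 (posfun_comp (posfun_integral P) measurable_uniform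
    mX1 (fun=> ler01))).
move=> /(_ _ h mh h0) => -> //.
  by congr (_ * _); apply: eq_integral => w _; rewrite mule1.
move=> B mB.
transitivity (\int[lam]_x ((G (enorm x))%:E * (\1_(dirset B) x)%:E)).
  apply: eq_integral => x _; rewrite -!EFinM; congr (_%:E).
  rewrite /Y mulrCA; congr (_ * _)%R.
  rewrite !indicE -natrM mulnb; congr (nat_of_bool _)%:R.
  apply/andP/idP; rewrite !inE /dirset/=; first by move=> [? []].
  by move=> [? ?]; split.
have mGE : measurable_fun setT (EFin \o G) by exact/measurable_EFinP.
have GE0 x : 0 <= (EFin \o G) x by rewrite lee_fin.
rewrite (lebN_radial_integral mB mGE GE0).
rewrite -pXE// muleC cE; congr (_ * _).
under [RHS]eq_integral do rewrite mule1.
rewrite (_ : (fun w => _) = (fun w => (\1_(X @^-1` B) w)%:E)) ?integral_indic ?setIT//.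
by rewrite -[X in measurable X]setTI; exact: measurable_uniform.
Qed.

End polar.

(** * Moments *)

Section hyperbolic_cosine.
Context (R : realType).
Implicit Types x t u v : R.

Definition coshR x : R := (expR x + expR (- x)) / 2.
Definition cosh_coeff x (k : nat) : R := x ^+ k.*2 / (k.*2)`!%:R.

Lemma coshR_ge0 x : 0 <= coshR x.
Proof. by rewrite divr_ge0// addr_ge0// expR_ge0. Qed.

Lemma cosh_coeff_ge0 x k : 0 <= cosh_coeff x k.
Proof. by rewrite divr_ge0// exprn_even_ge0// odd_double. Qed.

Lemma cosh_coeffM t x k : cosh_coeff (t * x) k = t ^+ k.*2 * cosh_coeff x k.
Proof. by rewrite /cosh_coeff exprMn mulrA. Qed.

(** Half the sum of the exponential series at [x] and [- x], cut after an even number of terms: the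
    odd powers cancel. *)
Lemma cosh_series x : \sum_(0 <= k < m) cosh_coeff x k @[m --> \oo] --> coshR x.
Proof.
have sumE m : \sum_(0 <= k < m) cosh_coeff x k =
    (series (exp_coeff x) m.*2 + series (exp_coeff (- x)) m.*2) / 2.
  elim: m => [|m ih].
    by rewrite /series/= !big_geq// addr0 mul0r.
  rewrite big_nat_recr//= ih /series/= doubleS !big_nat_recr//=.
  have xN : (- x) ^+ m.*2 = x ^+ m.*2 by rewrite -mul2n !exprM sqrrN.
  rewrite /cosh_coeff /exp_coeff/= !exprS xN mulNr; lra.
under eq_cvg do rewrite sumE.
have dbl : m.*2 @[m --> \oo] --> \oo.
  move=> A [n _ nA]; exists n => // m /= nm; apply: nA => /=.
  by rewrite (leq_trans nm)// -addnn leq_addr.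
apply: cvgMl; apply: cvgD.
  exact: (cvg_comp _ _ dbl (is_cvg_series_exp_coeff x)).
exact: (cvg_comp _ _ dbl (is_cvg_series_exp_coeff (- x))).
Qed.

Lemma nneseries_cosh_coeff x :
  (\sum_(0 <= k <oo) (cosh_coeff x k)%:E)%E = (coshR x)%:E.
Proof.
apply/cvg_lim => //; under eq_cvg do rewrite sumEFin.
apply: cvg_EFin; first exact: nearW.
exact: cosh_series.
Qed.

Lemma coshR_ge1D x : 1 + x ^+ 2 / 2 <= coshR x.
Proof.
rewrite -(cvg_lim _ (@cosh_series x))//; apply: limr_ge.
  by apply/cvg_ex; exists (coshR x); exact: cosh_series.
near=> m.
have -> : m = m.-2.+2 by rewrite -[in LHS](@subnK 2 m) ?addn2 ?subn2//; near: m; exists 2%N.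
rewrite big_nat_recl// big_nat_recl//= /cosh_coeff expr0 divr1 addrA lerDl.
by apply: sumr_ge0 => k _; exact: cosh_coeff_ge0.
Unshelve. all: by end_near. Qed.

(** From the fourth power on, every term of the series at [t * u] is at most [t ^+ 4] times the term
    at [u]. This makes the remainder beyond second order small uniformly enough to be integrated. *)
Lemma coshR_le t u : 0 <= t <= 1 ->
  coshR (t * u) <= 1 + t ^+ 2 * u ^+ 2 / 2 + t ^+ 4 * coshR u.
Proof.
move=> /andP[t0 t1].
have cv : (1 + t ^+ 2 * u ^+ 2 / 2 + t ^+ 4 * \sum_(0 <= k < m) cosh_coeff u k)
    @[m --> \oo] --> 1 + t ^+ 2 * u ^+ 2 / 2 + t ^+ 4 * coshR u.
  by apply: cvgD; [exact: cvg_cst|apply: cvgMr; exact: cosh_series].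
rewrite -(cvg_lim _ cv)// -(cvg_lim _ (@cosh_series (t * u)))//.
apply: ler_lim.
- by apply/cvg_ex; exists (coshR (t * u)); exact: cosh_series.
- by apply/cvg_ex; eexists; exact: cv.
near=> m.
have -> : m = m.-2.+2 by rewrite -[in LHS](@subnK 2 m) ?addn2 ?subn2//; near: m; exists 2%N.
have t4 : 0 <= t ^+ 4 by rewrite exprn_ge0.
have hs : \sum_(0 <= k < m.-2) cosh_coeff (t * u) k.+2 <=
    t ^+ 4 * \sum_(0 <= k < m.-2) cosh_coeff u k.+2.
  rewrite mulr_sumr; apply: ler_sum => k _.
  by rewrite cosh_coeffM ler_wpM2r ?cosh_coeff_ge0// ler_wiXn2l// !doubleS.
rewrite !big_nat_recl//=.
have -> : cosh_coeff (t * u) 0 = 1 by rewrite /cosh_coeff expr0 divr1.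
have -> : cosh_coeff (t * u) 1 = t ^+ 2 * u ^+ 2 / 2 by rewrite /cosh_coeff exprMn.
have p0 := mulr_ge0 t4 (cosh_coeff_ge0 u 0).
have p1 := mulr_ge0 t4 (cosh_coeff_ge0 u 1).
by rewrite !mulrDr; lra.
Unshelve. all: by end_near. Qed.

(** The convex function [u ^+ k] lies above its tangent at 1. Written without subtraction, both
    sides are nonnegative and can be integrated as such. *)
Lemma bernoulli u k : 0 <= u -> 1 + k%:R * u <= u ^+ k + k%:R.
Proof.
move=> u0; elim: k => [|k ih]; first by rewrite expr0 mul0r !addr0.
have h1 : u * (1 + k%:R * u) <= u * (u ^+ k + k%:R) by rewrite ler_wpM2l.
have h2 : 0 <= k%:R * (u - 1) ^+ 2 by rewrite mulr_ge0// sqr_ge0.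
rewrite exprS -natr1; move: h1 h2.
rewrite !mulrDr; move: (u * u ^+ k) => a; move: (k%:R : R) => b; nra.
Qed.

(** The reciprocal of the left side is at least [1 - v + v ^+ 2], and the product of this with
    [1 + v] is [1 + v ^+ 3 >= 1]. *)
Lemma expRB_sqr_le v : 0 <= v -> expR (v - v ^+ 2) <= 1 + v.
Proof.
move=> v0; have h := expR_ge1Dx (- (v - v ^+ 2)).
have h1 : 0 < 1 + - (v - v ^+ 2) by nra.
rewrite -[v - _]opprK expRN -[leRHS]invrK lef_pV2 ?posrE ?expR_gt0//; last first.
  by rewrite invr_gt0; lra.
apply: le_trans h; rewrite -div1r ler_pdivrMr; last lra.
nra.
Qed.

Lemma expR_le_1DxexpR v : 0 <= v -> expR v <= 1 + v * expR v.
Proof.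
move=> v0; have := expR_ge1Dx (- v); rewrite expRN -div1r.
rewrite ler_pdivlMr ?expR_gt0//; lra.
Qed.

Lemma exprn_le_expR u k : 0 <= u -> u ^+ k <= k`!%:R * expR u.
Proof.
move=> u0; case: k => [|k]; first by rewrite expr0 mul1r -[leLHS]expR0 ler_expR.
have := expR_ge1Dxn k u0 => h.
rewrite mulrC -ler_pdivrMr ?ltr0n ?fact_gt0//.
by apply: le_trans h; rewrite lerDr.
Qed.

Lemma measurable_coshR : measurable_fun setT coshR.
Proof.
apply: measurable_funM => //; apply: measurable_funD => //.
by apply: measurableT_comp.
Qed.

Lemma measurable_cosh_coeff k : measurable_fun setT (cosh_coeff^~ k).
Proof. by apply: measurable_funM => //; exact: exprn_measurable. Qed.

End hyperbolic_cosine.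

(** * Second moments and radial moments of the standard Gaussian vector *)

Section gaussian_moments.
Context (R : realType) (N : nat).
Local Open Scope ereal_scope.
Notation V := (Rrow R N).
Notation gam := (@gaussN R N).

Lemma measurable_dotpr (y : 'rV[R]_N) : measurable_fun setT (fun x : V => dotp y x).
Proof.
apply: (@measurable_dotp R N _ V (fun=> y) id); first exact: measurable_cst.
exact: measurable_id.
Qed.

Lemma gaussN_coshR (y : 'rV[R]_N) :
  \int[gam]_x (coshR (dotp y x))%:E = (expR (sqnorm y / 2))%:E.
Proof.
have m (z : 'rV[R]_N) : measurable_fun setT (fun x : V => (expR (dotp z x))%:E).
  apply/measurable_EFinP; apply: measurableT_comp => //; exact: measurable_dotpr.
transitivity (\int[gam]_x ((2^-1)%:E *
    ((expR (dotp y x))%:E + (expR (dotp (-1 *: y) x))%:E))).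
  apply: eq_integral => x _; rewrite -EFinD -EFinM dotpZl mulN1r.
  by rewrite /coshR mulrC.
rewrite ge0_integralZl_EFin//; [|by move=> x _; rewrite adde_ge0// lee_fin expR_ge0|exact: emeasurable_funD].
rewrite ge0_integralD//; try by move=> x _; rewrite lee_fin expR_ge0.
rewrite !gaussN_mgf sqnormZ sqrrN expr1n mul1r -EFinD -EFinM; congr (_%:E).
by field.
Qed.

Lemma gaussN_second_moment (y : 'rV[R]_N) :
  \int[gam]_x (dotp y x ^+ 2)%:E = (sqnorm y)%:E.
Proof.
set q := sqnorm y; have q0 : (0 <= q)%R by exact: sqnorm_ge0.
have m2 : measurable_fun setT (fun x : V => (dotp y x ^+ 2)%:E).
  by apply/measurable_EFinP; apply: measurable_funX; exact: measurable_dotpr.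
have p2 (x : V) : 0 <= (dotp y x ^+ 2)%:E by rewrite lee_fin sqr_ge0.
have mc : measurable_fun setT (fun x : V => (coshR (dotp y x))%:E).
  apply/measurable_EFinP; apply: (measurableT_comp (@measurable_coshR R)).
  exact: measurable_dotpr.
set M := \int[gam]_x _.
have M0 : 0 <= M by apply: integral_ge0.
(* both bounds come from the mgf of [s y], letting [s] tend to [0] *)
have ubs (s : R) : (0 < s)%R -> 1 + (s ^+ 2 / 2)%:E * M <= (expR (s ^+ 2 * q / 2))%:E.
  move=> s0; rewrite -/q -sqnormZ -gaussN_coshR.
  have -> : 1 + (s ^+ 2 / 2)%:E * M =
      \int[gam]_x (1 + (s ^+ 2 / 2)%:E * (dotp y x ^+ 2)%:E).
    rewrite ge0_integralD//; last 2 first.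
    - by move=> x _; rewrite mule_ge0// lee_fin divr_ge0// sqr_ge0.
    - exact: emeasurable_funM.
    rewrite integral_cst//= mul1e gaussN_setT ge0_integralZl_EFin//.
    by rewrite divr_ge0// sqr_ge0.
  apply: ge0_le_integral => //.
  - move=> x _; rewrite adde_ge0// mule_ge0// lee_fin divr_ge0// sqr_ge0//.
  - by apply: emeasurable_funD => //; exact: emeasurable_funM.
  - apply/measurable_EFinP; apply: (measurableT_comp (@measurable_coshR R)).
    exact: measurable_dotpr.
  - move=> x _; rewrite -EFinM -EFinD lee_fin dotpZl.
    by apply: le_trans (coshR_ge1D _); rewrite exprMn; lra.
have Mfin : M \is a fin_num.
  rewrite ge0_fin_numE// ltNge leye_eq; apply/negP => /eqP Moo.
  by have := ubs 1%R ltr01; rewrite Moo gt0_muley ?lte_fin ?divr_gt0 ?exprn_gt0.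
have lbs (s : R) : (0 < s <= 1)%R -> (expR (s ^+ 2 * q / 2))%:E <=
    1 + (s ^+ 2 / 2)%:E * M + (s ^+ 4)%:E * (expR (q / 2))%:E.
  move=> /andP[s0 s1]; rewrite -/q -sqnormZ -!gaussN_coshR.
  have s20 : (0 <= s ^+ 2 / 2)%R by rewrite divr_ge0// sqr_ge0.
  have s40 : (0 <= s ^+ 4)%R by rewrite exprn_ge0// ltW.
  have c0 (x : V) : 0 <= (coshR (dotp y x))%:E by rewrite lee_fin coshR_ge0.
  have h1 (x : V) : 0 <= 1 + (s ^+ 2 / 2)%:E * (dotp y x ^+ 2)%:E.
    by rewrite adde_ge0// mule_ge0.
  have h2 (x : V) : 0 <= (s ^+ 4)%:E * (coshR (dotp y x))%:E by rewrite mule_ge0.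
  have mh1 : measurable_fun setT (fun x : V => 1 + (s ^+ 2 / 2)%:E * (dotp y x ^+ 2)%:E).
    by apply: emeasurable_funD => //; exact: emeasurable_funM.
  have mh2 : measurable_fun setT (fun x : V => (s ^+ 4)%:E * (coshR (dotp y x))%:E).
    exact: emeasurable_funM.
  have -> : 1 + (s ^+ 2 / 2)%:E * M +
      (s ^+ 4)%:E * (\int[gam]_x (coshR (dotp y x))%:E) =
      \int[gam]_x (1 + (s ^+ 2 / 2)%:E * (dotp y x ^+ 2)%:E +
        (s ^+ 4)%:E * (coshR (dotp y x))%:E).
    rewrite ge0_integralD// ge0_integralD//; last 2 first.
    - by move=> x _; rewrite mule_ge0.
    - exact: emeasurable_funM.
    by rewrite integral_cst//= mul1e gaussN_setT !ge0_integralZl_EFin.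
  apply: ge0_le_integral => //.
  - by move=> x _; rewrite lee_fin coshR_ge0.
  - apply/measurable_EFinP; apply: (measurableT_comp (@measurable_coshR R)).
    exact: measurable_dotpr.
  - by apply: emeasurable_funD.
  - move=> x _; rewrite -!EFinM -!EFinD lee_fin dotpZl.
    apply: le_trans (coshR_le _ _) _; first by rewrite ltW.
    by rewrite lerD2r lerD2l; lra.
rewrite -(fineK Mfin) in ubs lbs *.
move: (fine M) ubs lbs => a ubs lbs.
congr (_%:E); apply/eqP; rewrite eq_le.
have E0 : (0 < expR (q / 2))%R by exact: expR_gt0.
set E := expR (q / 2) in lbs E0.
(* A positive [s <= 1] with [s ^+ 2 <= e], the size of [s] needed to make the error terms at most a
   given bound. *)
pose sq (e : R) : R := Num.sqrt (Num.min 1%R e).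
have sqP e : (0 < e)%R -> [/\ (0 < sq e)%R, (sq e <= 1)%R & (sq e ^+ 2 <= e)%R].
  move=> e0; have m0 : (0 < Num.min 1 e)%R by rewrite lt_min ltr01.
  split; first by rewrite sqrtr_gt0.
    by rewrite -[X in (_ <= X)%R]sqrtr1 ler_wsqrtr// ge_min lexx.
  by rewrite /sq sqr_sqrtr ?(ltW m0)// ge_min lexx orbT.
apply/andP; split; apply/ler_addgt0Pr => e e0.
  (* After division by [u = s ^+ 2] the error is at most [u * (q ^+ 2 * E)]; the added 1 keeps the
     divisor of [e] positive when [q = 0]. *)
  have K0 : (0 < q ^+ 2 * E + 1)%R by rewrite ltr_wpDl// mulr_ge0 ?sqr_ge0// ltW.
  have [s0 s1 s2] := sqP _ (divr_gt0 e0 K0).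
  move: (sq _) s0 s1 s2 => s s0 s1; rewrite ler_pdivlMr// => s2.
  have := ubs s s0; rewrite -EFinM -EFinD lee_fin => h.
  have ss0 : (0 < s ^+ 2)%R by rewrite exprn_gt0.
  have ss1 : (s ^+ 2 <= 1)%R by rewrite expr_le1// ltW.
  move: (s ^+ 2)%R ss0 ss1 s2 h => u u0 u1 u2 h.
  have v0 : (0 <= u * q / 2)%R by rewrite divr_ge0// mulr_ge0// ltW.
  have h2 := expR_le_1DxexpR v0.
  have h3 : (expR (u * q / 2) <= E)%R by rewrite ler_expR ler_pM2r// ler_piMl.
  have h4 : (expR (u * q / 2) <= 1 + u * q / 2 * (1 + u * q / 2 * E))%R.
    apply: (le_trans h2); rewrite lerD2l ler_wpM2l//.
    by apply: (le_trans h2); rewrite lerD2l ler_wpM2l.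
  have h5 : (u * a <= u * (q + u * (q ^+ 2 * E)))%R.
    have : (0 <= u * (u * (q ^+ 2 * E)))%R.
      by rewrite !mulr_ge0 ?sqr_ge0// ltW.
    by move: (le_trans h h4); rewrite expr2; nra.
  rewrite ler_pM2l// in h5; apply: (le_trans h5); rewrite lerD2l.
  by apply: le_trans u2; rewrite ler_pM2l// lerDl.
have K0 : (0 < 2 * E)%R by rewrite mulr_gt0.
have [s0 s1 s2] := sqP _ (divr_gt0 e0 K0).
move: (sq _) s0 s1 s2 => s s0 s1; rewrite ler_pdivlMr// => s2.
have := lbs s; rewrite s0 s1 => /(_ isT).
rewrite -!EFinM -!EFinD lee_fin => h.
have h1 := le_trans (expR_ge1Dx _) h.
have ss0 : (0 < s ^+ 2)%R by rewrite exprn_gt0.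
have s4 : (s ^+ 4 = s ^+ 2 * s ^+ 2)%R by rewrite -exprD.
rewrite s4 in h1; move: (s ^+ 2)%R ss0 s2 h1 => u u0 u2 h1.
have h5 : (u * q <= u * (a + u * (2 * E)))%R by lra.
rewrite ler_pM2l// in h5; apply: (le_trans h5); by rewrite lerD2l.
Qed.

Lemma gaussN_sqnorm : \int[gam]_x (sqnorm x)%:E = N%:R%:E.
Proof.
under eq_integral do rewrite /sqnorm -sumEFin.
rewrite ge0_integral_sum//; last 2 first.
- move=> k; apply/measurable_EFinP; apply: measurable_funX.
  exact: measurable_Rrow_coord.
- by move=> k x _; rewrite lee_fin sqr_ge0.
have dE (k : 'I_N) (x : 'rV[R]_N) : dotp (delta_mx ord0 k) x = x 0%R k.
  rewrite /dotp (bigD1 k)//= big1 ?addr0 ?mxE ?eqxx ?mul1r//.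
  by move=> j jk; rewrite mxE eqxx/= (negbTE jk) mul0r.
have sE (k : 'I_N) : sqnorm (delta_mx ord0 k : 'rV[R]_N) = 1%R.
  rewrite /sqnorm (bigD1 k)//= big1 ?addr0 ?mxE ?eqxx ?expr1n//.
  by move=> j jk; rewrite mxE eqxx/= (negbTE jk) expr0n.
under eq_bigr => k _.
  under eq_integral do rewrite -dE.
  rewrite gaussN_second_moment sE.
  over.
by rewrite sumEFin sumr_const card_ord.
Qed.

Definition gauss_radius_moment k : R := fine (\int[gam]_x (enorm x ^+ k.*2)%:E).

Lemma measurable_enormX k : measurable_fun setT (fun x : V => (enorm x ^+ k)%:E).
Proof. by apply/measurable_EFinP; apply: measurable_funX; exact: measurable_enorm. Qed.

(** Finiteness: with [u] a quarter of the squared norm, the integrand is [4 ^+ k * u ^+ k], at most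
    [C * expR u], and [expR u] is integrable as the quadratic exponential moment at [b = 1/2]. *)
Lemma gauss_radius_momentE k :
  \int[gam]_x (enorm x ^+ k.*2)%:E = (gauss_radius_moment k)%:E.
Proof.
rewrite fineK// ge0_fin_numE; last first.
  by apply: integral_ge0 => x _; rewrite lee_fin exprn_ge0// enorm_ge0.
pose C : R := (4 ^+ k * k`!%:R)%R.
have C0 : (0 <= C)%R by rewrite mulr_ge0// exprn_ge0.
have me : measurable_fun setT (fun x : V => (expR (2^-1 * sqnorm x / 2))%:E).
  apply/measurable_EFinP; apply: measurableT_comp => //.
  by apply: measurable_funM => //; apply: measurable_funM => //; exact: measurable_sqnorm.
apply: (@le_lt_trans _ _ (\int[gam]_x (C%:E * (expR (2^-1 * sqnorm x / 2))%:E))).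
  apply: ge0_le_integral => //.
  - by move=> x _; rewrite lee_fin exprn_ge0// enorm_ge0.
  - exact: measurable_enormX.
  - exact: emeasurable_funM.
  - move=> x _; rewrite -EFinM lee_fin -mul2n exprM enorm_sqr.
    have x0 := sqnorm_ge0 x.
    have u0 : (0 <= 2^-1 * sqnorm x / 2)%R by rewrite divr_ge0// mulr_ge0.
    have sE : (sqnorm x = 4 * (2^-1 * sqnorm x / 2))%R by field.
    rewrite [X in (X ^+ _)%R]sE; move: (2^-1 * sqnorm x / 2)%R u0 => u u0.
    by rewrite exprMn /C -[leRHS]mulrA ler_pM2l ?exprn_gt0//; exact: exprn_le_expR.
rewrite ge0_integralZl_EFin//.
by rewrite gaussN_mgf_sqr ?ltry//; lra.
Qed.

(* Jensen's inequality for [u |-> u ^+ k] and the radius, whose square has mean [N] *)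
Lemma gauss_radius_moment_ge k : (0 < N)%N ->
  (N%:R ^+ k <= gauss_radius_moment k)%R.
Proof.
move=> N0; have n0 : (0 < N%:R :> R)%R by rewrite ltr0n.
rewrite -lee_fin -gauss_radius_momentE.
pose c : R := (N%:R ^+ k)%R.
have c0 : (0 < c)%R by rewrite exprn_gt0.
(* The slope of [u ^+ k] at [u = N], where its value is [c]. The tangent is [c + b * (u - N)], and
   [b * N = c * k] is moved to the other side to keep the integrands nonnegative. *)
pose b : R := (c * k%:R / N%:R)%R.
have b0 : (0 <= b)%R by rewrite divr_ge0// mulr_ge0// ltW.
have ms : measurable_fun setT (fun x : V => (sqnorm x)%:E).
  by apply/measurable_EFinP; exact: measurable_sqnorm.
have : \int[gam]_x (c%:E + b%:E * (sqnorm x)%:E) <=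
    \int[gam]_x ((enorm x ^+ k.*2)%:E + (c * k%:R)%:E).
  apply: ge0_le_integral => //.
  - by move=> x _; rewrite adde_ge0 ?mule_ge0// lee_fin ?sqnorm_ge0// ltW.
  - by apply: emeasurable_funD => //; exact: emeasurable_funM.
  - by apply: emeasurable_funD => //; exact: measurable_enormX.
  - move=> x _; rewrite -EFinM -!EFinD lee_fin -mul2n exprM enorm_sqr.
    have u0 : (0 <= sqnorm x / N%:R)%R by rewrite divr_ge0 ?sqnorm_ge0.
    have := ler_wpM2l (ltW c0) (bernoulli k u0).
    rewrite expr_div_n -/c !mulrDr mulr1 [X in (_ <= X + _)%R -> _]mulrC.
    rewrite divfK ?gt_eqF//; apply: le_trans.
    by rewrite lerD2l /b; lra.
rewrite ge0_integralD//; last 3 first.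
- by move=> x _; rewrite lee_fin ltW.
- by move=> x _; rewrite mule_ge0// lee_fin// sqnorm_ge0.
- exact: emeasurable_funM.
rewrite ge0_integralD//; last 3 first.
- by move=> x _; rewrite lee_fin exprn_ge0// enorm_ge0.
- exact: measurable_enormX.
- by move=> x _; rewrite lee_fin mulr_ge0// ltW.
rewrite ge0_integralZl_EFin//; last by move=> x _; rewrite lee_fin sqnorm_ge0.
rewrite gaussN_sqnorm !integral_cst//= gaussN_setT !mule1 gauss_radius_momentE.
by rewrite -EFinM -!EFinD !lee_fin /b divfK ?gt_eqF// lerD2r.
Qed.

Lemma gauss_radius_moment1 : gauss_radius_moment 1 = N%:R.
Proof.
apply: EFin_inj; rewrite -gauss_radius_momentE -gaussN_sqnorm.
by apply: eq_integral => x _; rewrite enorm_sqr.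
Qed.

End gaussian_moments.

(** * Moment generating function of the uniform law on the sphere *)

Section uniform_mgf.
Context (R : realType) (N : nat) d (T : measurableType d).
Hypothesis N0 : (0 < N)%N.
Variables (P : probability T R) (X : T -> 'rV[R]_N).
Hypothesis uX : uniform_on_sphere P X.
Local Open Scope ereal_scope.
Notation V := (Rrow R N).
Notation gam := (@gaussN R N).

Let mX := measurable_uniform uX.

Lemma measurable_dotpX (y : 'rV[R]_N) : measurable_fun setT (fun w => dotp y (X w)).
Proof. exact: (measurableT_comp (measurable_dotpr y) mX). Qed.

(** By homogeneity the Gaussian integrand is [enorm x ^+ k.*2] times the same power of
    [dotp y (dir x)], and [gaussN_polar] separates the two factors. *)
Lemma uniform_even_moment k (y : 'rV[R]_N) :
  (gauss_radius_moment R N k)%:E * \int[P]_w (dotp y (X w) ^+ k.*2)%:E =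
  \int[gam]_x (dotp y x ^+ k.*2)%:E.
Proof.
have ev r : (0 <= r ^+ k.*2 :> R)%R by rewrite exprn_even_ge0// odd_double.
rewrite -(gaussN_polar N0 uX (h := fun x => (dotp y x ^+ k.*2)%:E)
  (g := fun r => (r ^+ k.*2)%R)) //.
- apply: eq_integral => x _; rewrite -EFinM; congr (_%:E).
  by rewrite -exprMn mulrC -dotpZr enormZdir.
- by apply/measurable_EFinP; apply: measurable_funX; exact: measurable_dotpr.
- by move=> x; rewrite lee_fin.
- exact: gauss_radius_momentE.
Qed.

Lemma uniform_second_moment (y : 'rV[R]_N) :
  \int[P]_w (dotp y (X w) ^+ 2)%:E = (sqnorm y / N%:R)%:E.
Proof.
have n0 : (N%:R != 0 :> R)%R by rewrite pnatr_eq0 -lt0n.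
have := uniform_even_moment 1 y.
rewrite gauss_radius_moment1 gaussN_second_moment => h.
transitivity ((N%:R^-1)%:E * (N%:R%:E * \int[P]_w (dotp y (X w) ^+ 1.*2)%:E)).
  by rewrite muleA -EFinM mulVf// mul1e.
by rewrite h -EFinM mulrC.
Qed.

(** The right side is the Gaussian mean of [coshR (dotp z x)] for [z = y / sqrt N]. The two series
    are compared term by term: their ratio is the radial moment over [N ^+ k], which is at least
    1. *)
Lemma uniform_coshR_le (y : 'rV[R]_N) :
  \int[P]_w (coshR (dotp y (X w)))%:E <= (expR (sqnorm y / (2 * N%:R)))%:E.
Proof.
have n0 : (0 < N%:R :> R)%R by rewrite ltr0n.
pose z := (Num.sqrt N%:R)^-1%R *: y.
have -> : (sqnorm y / (2 * N%:R) = sqnorm z / 2)%R.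
  rewrite /z sqnormZ exprVn sqr_sqrtr ?ltW//; field.
  by rewrite gt_eqF.
rewrite -gaussN_coshR.
under eq_integral do rewrite -nneseries_cosh_coeff.
under [leRHS]eq_integral do rewrite -nneseries_cosh_coeff.
have m1 k (u : 'rV[R]_N) : measurable_fun setT (fun w => (cosh_coeff (dotp u (X w)) k)%:E).
  apply/measurable_EFinP; apply: (measurableT_comp (@measurable_cosh_coeff R k)).
  exact: measurable_dotpX.
have m2 k (u : 'rV[R]_N) : measurable_fun setT (fun x : V => (cosh_coeff (dotp u x) k)%:E).
  apply/measurable_EFinP; apply: (measurableT_comp (@measurable_cosh_coeff R k)).
  exact: measurable_dotpr.
rewrite !integral_nneseries//; try by move=> *; rewrite lee_fin cosh_coeff_ge0.
apply: lee_nneseries => [k _ _|k _].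
  by apply: integral_ge0 => w _; rewrite lee_fin cosh_coeff_ge0.
pose c : R := ((k.*2)`!%:R)^-1%R.
have c0 : (0 <= c)%R by rewrite invr_ge0.
have ev r : (0 <= r ^+ k.*2 :> R)%R by rewrite exprn_even_ge0// odd_double.
have -> : \int[P]_w (cosh_coeff (dotp y (X w)) k)%:E =
    c%:E * \int[P]_w (dotp y (X w) ^+ k.*2)%:E.
  rewrite -ge0_integralZl_EFin//.
  - by apply: eq_integral => w _; rewrite -EFinM mulrC.
  - by move=> w _; rewrite lee_fin.
  - by apply/measurable_EFinP; apply: measurable_funX; exact: measurable_dotpX.
have -> : \int[gam]_x (cosh_coeff (dotp z x) k)%:E =
    (c / N%:R ^+ k)%:E * \int[gam]_x (dotp y x ^+ k.*2)%:E.
  rewrite -ge0_integralZl_EFin//.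
  - apply: eq_integral => x _; rewrite -EFinM /z dotpZl cosh_coeffM; congr (_%:E).
    rewrite /cosh_coeff -mul2n exprM exprVn sqr_sqrtr ?ltW// exprVn /c mul2n.
    by ring.
  - by move=> w _; rewrite lee_fin.
  - by apply/measurable_EFinP; apply: measurable_funX; exact: measurable_dotpr.
  - by rewrite divr_ge0// exprn_ge0// ltW.
rewrite -uniform_even_moment muleA -EFinM.
apply: lee_wpmul2r; first by apply: integral_ge0 => w _; rewrite lee_fin.
rewrite lee_fin -mulrA ler_peMr// mulrC ler_pdivlMr ?exprn_gt0// mul1r.
exact: gauss_radius_moment_ge.
Qed.

Lemma uniform_coshR_ge (y : 'rV[R]_N) :
  (1 + sqnorm y / (2 * N%:R))%:E <= \int[P]_w (coshR (dotp y (X w)))%:E.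
Proof.
have n0 : (0 < N%:R :> R)%R by rewrite ltr0n.
have m2 : measurable_fun setT (fun w => (dotp y (X w) ^+ 2)%:E).
  by apply/measurable_EFinP; apply: measurable_funX; exact: measurable_dotpX.
have -> : (1 + sqnorm y / (2 * N%:R))%:E =
    \int[P]_w (1 + (2^-1)%:E * (dotp y (X w) ^+ 2)%:E).
  rewrite ge0_integralD//; last 2 first.
  - by move=> w _; rewrite mule_ge0// lee_fin ?sqr_ge0.
  - exact: emeasurable_funM.
  rewrite integral_cst//= mul1e probability_setT ge0_integralZl_EFin//; last first.
    by move=> w _; rewrite lee_fin sqr_ge0.
  rewrite uniform_second_moment -EFinM -EFinD; congr (_%:E).
  by field; rewrite gt_eqF.
apply: ge0_le_integral => //.
- by move=> w _; rewrite adde_ge0// mule_ge0// lee_fin ?sqr_ge0.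
- by apply: emeasurable_funD => //; exact: emeasurable_funM.
- apply/measurable_EFinP; apply: (measurableT_comp (@measurable_coshR R)).
  exact: measurable_dotpX.
- move=> w _; rewrite -EFinM -EFinD lee_fin.
  by apply: le_trans (coshR_ge1D _); lra.
Qed.

(** Symmetry of the law of [X] is what is needed. [gaussN_polar] with [g = 1] makes it the law of
    [dir] under the Gaussian measure, where reflection preserves the density and reverses [dir]. *)
Lemma uniform_expR_coshR (y : 'rV[R]_N) :
  \int[P]_w (expR (dotp y (X w)))%:E = \int[P]_w (coshR (dotp y (X w)))%:E.
Proof.
have me (u : 'rV[R]_N) : measurable_fun setT (fun x : V => (expR (dotp u x))%:E).
  by apply/measurable_EFinP; apply: measurableT_comp => //; exact: measurable_dotpr.
have mXe (u : 'rV[R]_N) : measurable_fun setT (fun w => (expR (dotp u (X w)))%:E).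
  exact: (measurableT_comp (me u) mX).
have c1 : \int[gam]_x (1%R : R)%:E = 1 by rewrite integral_cst//= mul1e gaussN_setT.
have polE (u : 'rV[R]_N) : \int[P]_w (expR (dotp u (X w)))%:E =
    \int[gam]_x (expR (dotp u (dir x)))%:E.
  have := gaussN_polar N0 uX (h := fun x => (expR (dotp u x))%:E) (g := fun=> 1%R)
    (me u) (fun x => expR_ge0 _) (measurable_cst _) (fun=> ler01) c1.
  by rewrite mul1e => <-; apply: eq_integral => x _; rewrite mule1.
have sym : \int[P]_w (expR (dotp (-1 *: y) (X w)))%:E =
    \int[P]_w (expR (dotp y (X w)))%:E.
  have md (u : 'rV[R]_N) : measurable_fun setT (fun x : V => (expR (dotp u (dir x)))%:E).
    exact: (measurableT_comp (me u) (@measurable_dir R N)).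
  have e0 (u : 'rV[R]_N) (x : V) : 0 <= (expR (dotp u (dir x)))%:E.
    by rewrite lee_fin expR_ge0.
  rewrite !polE !integral_gaussN// integral_lebN_opp.
  - apply: eq_integral => x _; rewrite !gauss_densityE enormN dirN dotpZr dotpZl.
    by rewrite mulN1r mulN1r opprK.
  - apply: emeasurable_funM => //; apply/measurable_EFinP.
    exact: measurable_gauss_density.
  - by move=> x; rewrite mule_ge0// lee_fin gauss_density_ge0.
transitivity ((2^-1)%:E * (\int[P]_w (expR (dotp y (X w)))%:E +
    \int[P]_w (expR (dotp (-1 *: y) (X w)))%:E)).
  rewrite sym; set A := \int[P]_w _.
  have : 0 <= A by apply: integral_ge0 => w _; rewrite lee_fin expR_ge0.
  move: A => [a| |]// _; last by rewrite gt0_muley.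
  by rewrite -EFinD -EFinM; congr (_%:E); field.
rewrite -ge0_integralD//; try by move=> w _; rewrite lee_fin expR_ge0.
rewrite -ge0_integralZl_EFin//.
- apply: eq_integral => w _; rewrite -EFinD -EFinM dotpZl mulN1r /coshR.
  by rewrite mulrC.
- by move=> w _; rewrite adde_ge0// lee_fin expR_ge0.
- exact: emeasurable_funD.
Qed.

End uniform_mgf.

(** * Weighted sums of independent uniform vectors *)

Section independence.
Context (R : realType) (N n : nat) d (T : measurableType d).
Variables (P : probability T R) (X : 'I_n -> T -> 'rV[R]_N).
Hypothesis mX : forall j, measurable_fun setT (X j : T -> Rrow R N).
Hypothesis iX : mutually_independent P X.
Local Open Scope ereal_scope.
Notation V := (Rrow R N).

(* indicators are replaced by general functions one factor at a time *)
Let integral_prod_upto k (g : 'I_n -> V -> R) (c : 'I_n -> R) :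
  (forall j, measurable_fun setT (g j)) -> (forall j x, (0 <= g j x)%R) ->
  (forall j, \int[P]_w (g j (X j w))%:E = (c j)%:E) ->
  (forall j : 'I_n, (k <= j)%N -> exists2 B, measurable B & g j = \1_B) ->
  \int[P]_w (\prod_(j < n) g j (X j w))%:E = (\prod_(j < n) c j)%:E.
Proof.
elim: k g c => [|k ih] g c mg g0 gc gB.
  have /choice[B HB] : forall j, exists B, measurable B /\ g j = \1_B.
    by move=> j; have [B mB gE] := gB j isT; exists B.
  have mA j : measurable (X j @^-1` B j).
    by rewrite -[Y in measurable Y]setTI; apply: mX => //; have [] := HB j.
  have cE j : P (X j @^-1` B j) = (c j)%:E.
    rewrite -gc; have [_ ->] := HB j.
    by rewrite -[Y in P Y]setIT -integral_indic.
  have := iX (A := fun j => X j @^-1` B j).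
  under [in RHS]eq_bigr do rewrite cE.
  rewrite prodEFin => <-; last first.
    by move=> j; exists (B j); split => //; have [] := HB j.
  rewrite -[Y in P Y]setIT -integral_indic//; last first.
    by apply: fin_bigcap_measurable => //; exact: finite_finset.
  apply: eq_integral => w _; congr (_%:E).
  rewrite indicE; have [|] := boolP (w \in _).
    rewrite inE => h; rewrite big1// => j _; have [_ ->] := HB j.
    by rewrite indicE mem_set//; exact: h.
  move=> /negP wA; have [j wj] : exists j, ~ B j (X j w).
    apply: contrapT => h; apply: wA; rewrite inE => j _.
    by apply: contrapT => h'; apply: h; exists j.
  rewrite (bigD1 j)//=; have [_ ->] := HB j.
  by rewrite indicE memNset// mul0r.
have [nk|kn] := leqP n k.
  apply: (ih g c mg g0 gc) => j kj; exfalso.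
  by move: (leq_trans nk kj); rewrite leqNgt ltn_ord.
pose k' := Ordinal kn.
have c0 j : (0 <= c j)%R.
  by rewrite -lee_fin -gc; apply: integral_ge0 => w _; rewrite lee_fin.
pose C := (\prod_(j < n | j != k') c j)%R.
pose Y w := (\prod_(j < n | j != k') g j (X j w))%R.
have C0 : (0 <= C)%R by exact: prodr_ge0.
have Y0 w : (0 <= Y w)%R by apply: prodr_ge0.
have mY : measurable_fun setT Y.
  rewrite (_ : Y = fun w => \prod_(j < n) if j != k' then g j (X j w) else 1)%R;
    last by apply/funext => w; rewrite /Y big_mkcond.
  apply: measurable_prod => j _; case: (j != k') => //.
  exact: (measurableT_comp (mg j) (mX j)).
have m1 : measurable_fun setT (fun _ : T => 1%R : R) by [].
(* With the other factors frozen in the weight [Y], both sides are functionals of the factor at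
   [k']. They agree on indicators by the induction hypothesis, hence on [g k']. *)
have := eq_posfun (posfun_comp (posfun_integral P) (mX k') mY Y0)
  (posfun_scale C0 (posfun_comp (posfun_integral P) (mX k') m1 (fun=> ler01))).
move=> /(_ _ (EFin \o g k')) E.
transitivity (\int[P]_w ((EFin \o g k') (X k' w) * (Y w)%:E)).
  by apply: eq_integral => w _; rewrite (bigD1 k')//= EFinM.
rewrite E.
- under eq_integral do rewrite mule1.
  by rewrite gc (bigD1 k')//= mulrC EFinM.
- move=> A mA.
  pose g' j := if j == k' then \1_A else g j.
  pose c' j := if j == k' then fine (P (X k' @^-1` A)) else c j.
  have mXA : measurable (X k' @^-1` A).
    by rewrite -[Z in measurable Z]setTI; exact: mX.
  have PA : \int[P]_w (\1_A (X k' w))%:E = (fine (P (X k' @^-1` A)))%:E.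
    by rewrite fineK ?fin_num_measure// -[Z in P Z]setIT -integral_indic.
  have cE : (\prod_(j < n) c' j = C * fine (P (X k' @^-1` A)))%R.
    rewrite (bigD1 k')//= {1}/c' eqxx mulrC; congr (_ * _)%R.
    by apply: eq_bigr => j /negbTE jk; rewrite /c' jk.
  under [Z in _ = _ * Z]eq_integral do rewrite mule1.
  rewrite PA -EFinM -cE -(ih g' c').
  + apply: eq_integral => w _; rewrite (bigD1 k')//= /g' eqxx EFinM; congr (_ * _%:E).
    by apply: eq_bigr => j /negbTE jk; rewrite jk.
  + move=> j; rewrite /g'; case: (j == k') => //; exact: measurable_indic.
  + by move=> j x; rewrite /g'; case: (j == k').
  + by move=> j; rewrite /g' /c'; have [->|] := eqVneq j k'.
  + move=> j kj; rewrite /g'; have [jk|jk] := eqVneq j k'; first by exists A.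
    apply: gB; rewrite ltn_neqAle kj andbT; apply: contra jk => /eqP jk.
    by apply/eqP/val_inj.
- by apply/measurable_EFinP.
- by move=> x; rewrite lee_fin.
Qed.

Lemma integral_prod_independent (g : 'I_n -> V -> R) (c : 'I_n -> R) :
  (forall j, measurable_fun setT (g j)) -> (forall j x, (0 <= g j x)%R) ->
  (forall j, \int[P]_w (g j (X j w))%:E = (c j)%:E) ->
  \int[P]_w (\prod_(j < n) g j (X j w))%:E = (\prod_(j < n) c j)%:E.
Proof.
move=> mg g0 gc; apply: (integral_prod_upto (k := n)) => // j.
by rewrite leqNgt ltn_ord.
Qed.

End independence.

Section weighted_sum.
Context (R : realType) (N n : nat) d (T : measurableType d).
Hypothesis N0 : (0 < N)%N.
Variables (P : probability T R) (X : 'I_n -> T -> 'rV[R]_N) (a : 'I_n -> R).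
Hypothesis uX : forall j, uniform_on_sphere P (X j).
Hypothesis iX : mutually_independent P X.
Local Open Scope ereal_scope.
Notation V := (Rrow R N).
Notation gam := (@gaussN R N).

Definition wsum w : 'rV[R]_N := (\sum_(j < n) a j *: X j w)%R.

Lemma measurable_wsum : measurable_fun setT (wsum : T -> V).
Proof.
apply: measurable_fun_Rrow => k.
rewrite [Y in measurable_fun _ Y](_ : _ =
    fun w => \sum_(j < n) (a j * X j w 0 k))%R; last first.
  by apply/funext => w; rewrite summxE; apply: eq_bigr => j _; rewrite mxE.
by apply: measurable_sum => j; apply: measurable_funM => //; exact: (uX j).1.
Qed.

Lemma measurable_expR_wsum (s : R) :
  measurable_fun setT (fun w => (expR (s * sqnorm (wsum w)))%:E).
Proof.
apply/measurable_EFinP; apply: measurableT_comp => //; apply: measurable_funM => //.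
exact: (measurableT_comp (@measurable_sqnorm R N) measurable_wsum).
Qed.

Let mgfX (s : R) j (x : 'rV[R]_N) : R :=
  fine (\int[P]_w (expR (dotp ((Num.sqrt (2 * s) * a j) *: x) (X j w)))%:E).

Let mgfXE s j x :
  \int[P]_w (expR (dotp ((Num.sqrt (2 * s) * a j) *: x) (X j w)))%:E =
  (mgfX s j x)%:E.
Proof.
rewrite fineK// ge0_fin_numE; last first.
  by apply: integral_ge0 => w _; rewrite lee_fin expR_ge0.
rewrite (uniform_expR_coshR N0 (uX j)).
by rewrite (le_lt_trans (uniform_coshR_le N0 (uX j) _))// ltry.
Qed.

Let mgfX_ge0 s j x : (0 <= mgfX s j x)%R.
Proof. by apply: fine_ge0; apply: integral_ge0 => w _; rewrite lee_fin expR_ge0. Qed.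

Let mgfX_le s j x : (0 <= s)%R ->
  (mgfX s j x <= expR (s * sqnorm x / N%:R * a j ^+ 2))%R.
Proof.
move=> s0; rewrite -lee_fin -mgfXE (uniform_expR_coshR N0 (uX j)).
apply: le_trans (uniform_coshR_le N0 (uX j) _) _.
rewrite lee_fin ler_expR sqnormZ exprMn sqr_sqrtr ?mulr_ge0//.
by rewrite le_eqVlt; apply/orP; left; apply/eqP; field; rewrite pnatr_eq0 -lt0n.
Qed.

Let mgfX_ge s j x : (0 <= s)%R ->
  (1 + s * sqnorm x / N%:R * a j ^+ 2 <= mgfX s j x)%R.
Proof.
move=> s0; rewrite -lee_fin -mgfXE (uniform_expR_coshR N0 (uX j)).
apply: le_trans (uniform_coshR_ge N0 (uX j) _).
rewrite lee_fin sqnormZ exprMn sqr_sqrtr ?mulr_ge0//.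
by rewrite le_eqVlt; apply/orP; left; apply/eqP; field; rewrite pnatr_eq0 -lt0n.
Qed.

(* linearize the square with an auxiliary Gaussian vector, then exchange expectations *)
Lemma integral_expR_wsum (s : R) : (0 <= s)%R ->
  measurable_fun setT (fun x : V => (\prod_(j < n) mgfX s j x)%:E) /\
  \int[P]_w (expR (s * sqnorm (wsum w)))%:E =
  \int[gam]_x (\prod_(j < n) mgfX s j x)%:E.
Proof.
move=> s0; pose r := Num.sqrt (2 * s).
pose f (p : T * V) : \bar R := (expR (dotp ((r *: wsum p.1)%R : V) p.2))%:E.
have mf : measurable_fun setT f.
  apply/measurable_EFinP; apply: measurableT_comp => //.
  apply: (@measurable_dotp R N _ (T * V)%type (fun p => (r *: wsum p.1)%R : V) snd).
    apply: (measurableT_comp (@measurable_rowZ R N r)).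
    exact: (measurableT_comp measurable_wsum measurable_fst).
  exact: measurable_snd.
have f0 p : 0 <= f p by rewrite lee_fin expR_ge0.
have GE : (fun x : V => \int[P]_w f (w, x)) = (fun x => (\prod_(j < n) mgfX s j x)%:E).
  apply/funext => x.
  rewrite -(@integral_prod_independent R N n _ T P X _ iX
    (fun j y => expR (dotp ((r * a j) *: x)%R y)) (fun j => mgfX s j x)).
  - apply: eq_integral => w _; rewrite /f/= -expR_sum dotpZl dotp_suml mulr_sumr.
    congr ((expR _)%:E); apply: eq_bigr => j _.
    by rewrite dotpZl mulrA dotpC.
  - by move=> j; exact: (measurable_uniform (uX j)).
  - by move=> j; apply: measurableT_comp => //; exact: measurable_dotpr.
  - by move=> j y; exact: expR_ge0.
  - by move=> j; exact: mgfXE.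
split.
  rewrite -GE; exact: (@measurable_fun_fubini_tonelli_G _ _ T V R P f mf f0).
rewrite -GE -(@fubini_tonelli _ _ T V R P gam f mf f0).
apply: eq_integral => w _; rewrite /f/= gaussN_mgf sqnormZ sqr_sqrtr ?mulr_ge0//.
by congr ((expR _)%:E); field.
Qed.

(** The bounds [mgfX_le] multiply to [expR (b * sqnorm x / 2)], whose Gaussian integral is
    explicit. *)
Lemma integral_expR_wsum_le (s b : R) : (0 <= s)%R -> (b < 1)%R ->
  b = (2 * s / N%:R * \sum_(j < n) a j ^+ 2)%R ->
  \int[P]_w (expR (s * sqnorm (wsum w)))%:E <= ((Num.sqrt (1 - b))^-1 ^+ N)%:E.
Proof.
move=> s0 b1 bE; have [mp ->] := integral_expR_wsum s0.
rewrite -gaussN_mgf_sqr//; apply: ge0_le_integral => //.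
- by move=> x _; rewrite lee_fin; apply: prodr_ge0.
- apply/measurable_EFinP; apply: measurableT_comp => //; apply: measurable_funM => //.
  by apply: measurable_funM => //; exact: measurable_sqnorm.
- move=> x _; rewrite lee_fin.
  have -> : (b * sqnorm x / 2 = \sum_(j < n) s * sqnorm x / N%:R * a j ^+ 2)%R.
    by rewrite -mulr_sumr bE; field; rewrite pnatr_eq0 -lt0n.
  by rewrite expR_sum; apply: ler_prod => j _; rewrite mgfX_ge0 mgfX_le.
Qed.

(** Each factor is at least [1 + v] with [v = u / n] and [u = s * sqnorm x / N], hence at least
    [expR (v - v ^+ 2)]; the [n] factors multiply to [expR (u - u ^+ 2 / n)]. This bound does not
    involve [P], and its exponent increases with [n]. *)
Lemma integral_expR_wsum_ge (s : R) : (0 <= s)%R -> (0 < n)%N ->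
  (forall j, a j ^+ 2 = n%:R^-1)%R ->
  \int[gam]_x (expR (s * sqnorm x / N%:R - (s * sqnorm x / N%:R) ^+ 2 / n%:R))%:E <=
  \int[P]_w (expR (s * sqnorm (wsum w)))%:E.
Proof.
move=> s0 n0 aE; have [mp ->] := integral_expR_wsum s0.
have nn0 : (0 < n%:R :> R)%R by rewrite ltr0n.
have mu : measurable_fun setT (fun x : V => (s * sqnorm x / N%:R)%R).
  by apply: measurable_funM => //; apply: measurable_funM => //; exact: measurable_sqnorm.
apply: ge0_le_integral => //.
- apply/measurable_EFinP; apply: measurableT_comp => //; apply: measurable_funB => //.
  by apply: measurable_funM => //; exact: measurable_funX.
- move=> x _; rewrite lee_fin.
  set u := (s * sqnorm x / N%:R)%R.
  have u0 : (0 <= u)%R by rewrite divr_ge0// mulr_ge0// sqnorm_ge0.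
  have -> : (u - u ^+ 2 / n%:R = \sum_(j < n) (u / n%:R - (u / n%:R) ^+ 2))%R.
    rewrite sumr_const card_ord -mulr_natr; field.
    by rewrite gt_eqF.
  rewrite expR_sum; apply: ler_prod => j _; rewrite expR_ge0/=.
  apply: le_trans (expRB_sqr_le _) _; first by rewrite divr_ge0.
  by rewrite -[(n%:R)^-1%R](aE j) mgfX_ge.
Qed.

End weighted_sum.

(** * The constant b(N) and the Gaussian lower bound in the limit *)

Section constant.
Context (R : realType) (N : nat).
Hypothesis N0 : (0 < N)%N.

(** The value of [1 - b] at which the Gaussian integral [(1 - b)^(-N/2)] equals 2. *)
Definition qconst : R := (2^-1) `^ (2 / N%:R).

Lemma qconst_gt0 : 0 < qconst.
Proof. by rewrite powR_gt0// invr_gt0. Qed.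

Lemma sqrt_qconst : Num.sqrt qconst ^+ N = 2^-1.
Proof.
have n0 : (N%:R != 0 :> R) by rewrite pnatr_eq0 -lt0n.
have q0 := ltW qconst_gt0.
have h : (Num.sqrt qconst ^+ N) ^+ 2 = (2^-1) ^+ 2.
  rewrite exprAC sqr_sqrtr// -powR_mulrn// -powRrM divfK//.
  by rewrite powR_mulrn// invr_ge0.
apply/eqP; rewrite -(@eqrXn2 _ 2) ?invr_ge0 ?exprn_ge0 ?sqrtr_ge0//.
exact/eqP.
Qed.

Lemma qconst_lt1 : qconst < 1.
Proof.
rewrite ltNge; apply/negP => q1.
have s1 : 1 <= Num.sqrt qconst by rewrite -[leLHS]sqrtr1 ler_wsqrtr.
by have := exprn_ege1 N s1; rewrite sqrt_qconst; lra.
Qed.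

Lemma bconst_sqr : bconst R N ^+ 2 = 2 / N%:R / (1 - qconst).
Proof.
have q1 : 0 < 1 - qconst by rewrite subr_gt0 qconst_lt1.
rewrite /bconst exprMn !sqr_sqrtr ?divr_ge0//; last exact: ltW.
by rewrite div1r.
Qed.

(** The left side is the value of [c] at which [b = 2 / (N c^2)] reaches 1 and the Gaussian integral
    formula breaks down. The gap leaves room for a constant below [bconst R N] with [b < 1]. *)
Lemma bconst_gt : Num.sqrt (2 / N%:R) < bconst R N.
Proof.
have n0 : 0 < N%:R :> R by rewrite ltr0n.
have s0 : 0 < Num.sqrt (2 / N%:R) :> R by rewrite sqrtr_gt0 divr_gt0.
rewrite /bconst -[ltLHS]mulr1 ltr_pM2l// -[ltLHS]sqrtr1 ltr_sqrt.
  rewrite div1r invf_gt1 -/qconst ?subr_gt0 ?qconst_lt1//.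
  by rewrite ltrBlDr ltrDl qconst_gt0.
by rewrite divr_gt0// subr_gt0 qconst_lt1.
Qed.

Lemma bconst_gt0 : 0 < bconst R N.
Proof. by apply: le_lt_trans bconst_gt; exact: sqrtr_ge0. Qed.

End constant.

(** As [n] grows the exponents increase to [b * sqnorm x / 2]. If no integral exceeded [y], neither
    would their limit, which monotone convergence identifies as the integral without the
    correction. *)
Lemma gaussN_truncation_gt (R : realType) (N : nat) (b y : R) : b < 1 ->
  y < (Num.sqrt (1 - b))^-1 ^+ N ->
  exists n : nat, (y%:E < \int[@gaussN R N]_x
    (expR (b * sqnorm x / 2 - (b * sqnorm x / 2) ^+ 2 / n.+1%:R))%:E)%E.
Proof.
move=> b1 by_; apply: contrapT => /forallNP h.
pose u (x : Rrow R N) : R := b * sqnorm x / 2.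
pose g (n : nat) (x : Rrow R N) : \bar R := (expR (u x - u x ^+ 2 / n.+1%:R))%:E.
have mu : measurable_fun setT u.
  by apply: measurable_funM => //; apply: measurable_funM => //; exact: measurable_sqnorm.
have mg n : measurable_fun setT (g n).
  apply/measurable_EFinP; apply: measurableT_comp => //; apply: measurable_funB => //.
  by apply: measurable_funM => //; exact: measurable_funX.
have g0 n x : setT x -> (0 <= g n x)%E by rewrite lee_fin expR_ge0.
have ndg x : setT x -> nondecreasing_seq (g^~ x).
  move=> _ m n mn; rewrite lee_fin ler_expR lerD2l lerN2.
  by rewrite ler_wpM2l ?sqr_ge0// lef_pV2 ?posrE ?ltr0n// ler_nat.
have := @cvg_monotone_convergence _ _ R (@gaussN R N) setT measurableT g mg g0 ndg.
have -> : (\int[@gaussN R N]_x limn (g^~ x) = ((Num.sqrt (1 - b))^-1 ^+ N)%:E)%E.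
  rewrite -gaussN_mgf_sqr//; apply: eq_integral => x _; apply/cvg_lim => //.
  apply: cvg_EFin; first exact: nearW.
  apply: (@continuous_cvg _ _ _ _ _ (fun n : nat => u x - u x ^+ 2 / n.+1%:R) expR).
    exact: continuous_expR.
  have c0 : u x ^+ 2 / n.+1%:R @[n --> \oo] --> 0.
    rewrite -(mulr0 (u x ^+ 2)); apply: cvgMr; exact: cvg_harmonic.
  have := cvgB (cvg_cst (u x)) c0; rewrite subr0; exact.
move=> cvgI.
have : (limn (fun n => \int[@gaussN R N]_x g n x) <= y%:E)%E.
  apply: lime_le; first by apply/cvg_ex; eexists; exact: cvgI.
  by apply: nearW => n; rewrite leNgt; apply/negP; exact: h.
by rewrite (cvg_lim _ cvgI)// lee_fin leNgt by_.
Qed.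

Theorem theorem1 (R : realType) (N : nat) (hN : (1 <= N)%N) :
  (forall (d : measure_display) (T : measurableType d) (P : probability T R)
          (n : nat), (1 <= n)%N ->
   forall X : 'I_n -> T -> 'rV[R]_N,
     (forall j, uniform_on_sphere P (X j)) -> mutually_independent P X ->
   forall a : 'I_n -> R,
     (psi2_norm P (fun w => (\sum_(j < n) a j *: X j w)%R)
       <= ((bconst R N * Num.sqrt (\sum_(j < n) a j ^+ 2))%R)%:E)%E)
  /\
  (forall c : R, c < bconst R N ->
   exists (n : nat) (a : 'I_n -> R),
   forall (d : measure_display) (T : measurableType d) (P : probability T R)
          (X : 'I_n -> T -> 'rV[R]_N),
     (forall j, uniform_on_sphere P (X j)) -> mutually_independent P X ->
     (((c * Num.sqrt (\sum_(j < n) a j ^+ 2))%R)%:E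
       < psi2_norm P (fun w => (\sum_(j < n) a j *: X j w)%R))%E).
Proof.
have n0 : 0 < N%:R :> R by rewrite ltr0n.
have b0 := bconst_gt0 R hN.
have q1 := qconst_lt1 R hN.
have bE := bconst_sqr R hN.
split.
  move=> d T P n _ X uX iX a.
  have A0 : 0 <= \sum_(j < n) a j ^+ 2 by apply: sumr_ge0 => j _; exact: sqr_ge0.
  (* When all weights vanish the claimed bound is 0, which is not an admissible constant; the norm
     is then an infimum over all positive [e], each admissible because the expectation is 1. *)
  have [A_eq0|A_neq0] := eqVneq (\sum_(j < n) a j ^+ 2) 0.
    have aj0 j : a j = 0.
      move/eqP: A_eq0; rewrite psumr_eq0; last by move=> i _; exact: sqr_ge0.
      by move=> /allP/(_ j); rewrite mem_index_enum sqrf_eq0 => /(_ isT)/eqP.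
    rewrite A_eq0 sqrtr0 mulr0; apply/lee_addgt0Pr => e e0; rewrite add0e.
    apply: ereal_inf_lbound; exists e => //; split => //.
    rewrite (_ : (fun w => _) = fun=> 1%E); last first.
      apply/funext => w; rewrite enorm_sqr /sqnorm big1 ?mul0r ?expR0// => k _.
      by rewrite big1 ?mxE ?expr0n// => j _; rewrite aj0 scale0r.
    by rewrite integral_cst//= mul1e probability_setT lee_fin; lra.
  have A_gt0 : 0 < \sum_(j < n) a j ^+ 2 by rewrite lt_neqAle eq_sym A_neq0.
  set c := bconst R N * _.
  have c0 : 0 < c by rewrite mulr_gt0// sqrtr_gt0.
  have cE : c ^+ 2 = bconst R N ^+ 2 * \sum_(j < n) a j ^+ 2.
    by rewrite exprMn sqr_sqrtr.
  apply: ereal_inf_lbound; exists c => //; split => //.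
  under eq_integral do rewrite enorm_sqr mulrC.
  apply: le_trans (@integral_expR_wsum_le R N n d T hN P X a uX iX
    (c ^+ 2)^-1 (1 - qconst R N) _ _ _) _.
  - by rewrite invr_ge0 sqr_ge0.
  - by rewrite ltrBlDr ltrDl qconst_gt0.
  - rewrite cE bE; field.
    by rewrite A_neq0 pnatr_eq0 -lt0n hN subr_eq0 eq_sym lt_eqF.
  - by rewrite subKr exprVn sqrt_qconst// invrK.
move=> c cb.
pose r : R := Num.sqrt (2 / N%:R).
have r0 : 0 < r by rewrite sqrtr_gt0 divr_gt0.
(* Above [c], so that the final inequality is strict; above [r], so that [b < 1]; below
   [bconst R N], so that the Gaussian integral exceeds 2. *)
pose c' := (Num.max c r + bconst R N) / 2.
have mb : Num.max c r < bconst R N by rewrite gt_max cb bconst_gt.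
have cc' : c < c'.
  have : c <= Num.max c r by rewrite le_max lexx.
  by rewrite /c'; lra.
have rc' : r < c'.
  have : r <= Num.max c r by rewrite le_max lexx orbT.
  by rewrite /c'; lra.
have c'b : c' < bconst R N by rewrite /c'; lra.
have c'0 : 0 < c' by exact: lt_trans rc'.
pose s := (c' ^+ 2)^-1; pose b := 2 * s / N%:R.
have c'20 : 0 < c' ^+ 2 by rewrite exprn_gt0.
have s0 : 0 <= s by rewrite invr_ge0 ltW.
have b1 : b < 1.
  have : r ^+ 2 < c' ^+ 2 by rewrite ltrXn2r// ltW.
  rewrite sqr_sqrtr ?divr_ge0// => h.
  by rewrite /b /s mulrAC ltr_pdivrMr// mul1r.
have bq : 1 - b < qconst R N.
  have : c' ^+ 2 < bconst R N ^+ 2 by rewrite ltrXn2r// ltW.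
  rewrite bE ltr_pdivlMr ?subr_gt0// => h.
  suff : 1 - qconst R N < b by lra.
  by rewrite /b /s mulrAC ltr_pdivlMr// mulrC.
(* The number of summands is fixed by a purely Gaussian estimate, before any probability space is
   given. *)
have [m hm] : exists m : nat, (2%:E < \int[@gaussN R N]_x
    (expR (b * sqnorm x / 2 - (b * sqnorm x / 2) ^+ 2 / m.+1%:R))%:E)%E.
  apply: gaussN_truncation_gt => //.
  rewrite exprVn -[ltLHS]invrK ltf_pV2 ?posrE ?exprn_gt0 ?sqrtr_gt0 ?subr_gt0 ?invr_gt0//.
  rewrite -(sqrt_qconst R hN) ltrXn2r ?sqrtr_ge0//; first by rewrite -lt0n.
  by rewrite ltr_sqrt// qconst_gt0.
pose a (j : 'I_m.+1) : R := (Num.sqrt m.+1%:R)^-1.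
have aE j : a j ^+ 2 = m.+1%:R^-1 by rewrite exprVn sqr_sqrtr.
exists m.+1, a => d T P X uX iX.
have -> : \sum_(j < m.+1) a j ^+ 2 = 1.
  under eq_bigr do rewrite aE.
  by rewrite sumr_const card_ord -[_ *+ _]mulr_natr mulVf// pnatr_eq0.
rewrite sqrtr1 mulr1.
apply: (@lt_le_trans _ _ c'%:E); first by rewrite lte_fin.
(* [c'] is a lower bound of the admissible constants: for [e < c'] the expectation at [e] is at
   least the one at [c'], which exceeds 2. *)
apply: le_ereal_inf_tmp => _ [e [e0 he] <-]; rewrite lee_fin leNgt; apply/negP => ec'.
suff : (2%:E < 2%:E :> \bar R)%E by rewrite ltxx.
apply: (lt_le_trans hm); apply: le_trans he.
have bE' x : b * x / 2 = s * x / N%:R by rewrite /b; field; rewrite gt_eqF.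
under eq_integral do rewrite !bE'.
apply: le_trans (@integral_expR_wsum_ge R N m.+1 d T hN P X a uX iX s s0 isT aE) _.
apply: ge0_le_integral => //.
- exact: measurable_expR_wsum.
- under eq_fun do rewrite enorm_sqr mulrC.
  exact: measurable_expR_wsum.
- move=> w _; rewrite lee_fin ler_expR enorm_sqr mulrC ler_wpM2l ?sqnorm_ge0//.
  by rewrite /s lef_pV2 ?posrE ?exprn_gt0// lerXn2r ?nnegrE ?(ltW e0) ?(ltW c'0) ?(ltW ec').
Qed.
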